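(* Let $X$ be a compact complex manifold of dimension $n$, $Z\subset X$ a closed complex submanifold of complex codimension $r\geq2$, and $\pi:\tilde X\to X$ the blow-up of $X$ with center $Z$. Given an integral divisor or $\mathbb{Q}$-divisor $D$ on $X$, put $\tilde D=\pi^*D$. Then $$\mathrm{vol}_{\tilde X}(\tilde D)=\mathrm{vol}_X(D).$$
   Context: For a line bundle $L$ on an irreducible compact complex space $X$ of dimension $n$, the volume is $\mathrm{vol}_X(L)=\limsup_{m\to\infty}\frac{h^0(X,L^{\otimes m})}{m^n/n!}$, where $h^0=\dim_{\mathbb{C}}H^0$. The volume of an integral (Cartier) divisor $D$ is $\mathrm{vol}_X(D)=\mathrm{vol}_X(\mathcal{O}_X(D))$. For a $\mathbb{Q}$-divisor $D$, choose a positive integer $a$ such that $aD$ is integral and set $\mathrm{vol}_X(D)=a^{-n}\,\mathrm{vol}_X(aD)$ (the same $a$ may be used for $\pi^*D$). *)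

(* Defs.v *)
From mathcomp Require Export all_boot all_order all_algebra.
From mathcomp Require Export all_classical all_reals all_analysis.
From mathcomp Require Export complex.

Set Implicit Arguments.
Unset Strict Implicit.
Unset Printing Implicit Defensive.

Import Order.TTheory GRing.Theory Num.Theory numFieldNormedType.Exports.

Local Open Scope classical_set_scope.
Local Open Scope ring_scope.

(** * Complex manifolds *)

(* [g] is holomorphic at [p] in the coordinates [f]: near [p] it factors as
   [h \o f] with [h] complex differentiable in a neighbourhood of [f p]
   ([differentiable] is relative to the scalar field, here [R[i]]). *)
Definition holo_in_chart (R : realType) (X : topologicalType)
    (V W : normedModType R[i]) (f : X -> V) (g : X -> W) (p : X) : Prop :=
  exists h : V -> W,
    (\forall y \near f p, differentiable h y) /\
    (\forall q \near p, g q = h (f q)).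

(* A chart is a pair (domain, coordinate map); the values of the map outside
   the domain are irrelevant. *)
Definition chart (R : realType) (n : nat) (X : Type) : Type :=
  (set X * (X -> 'rV[R[i]]_n))%type.

(* [f] restricts to a homeomorphism from the open set [U] onto an open set *)
Definition open_homeo (X Y : topologicalType) (U : set X) (f : X -> Y) : Prop :=
  [/\ open U,
      (forall p q, U p -> U q -> f p = f q -> p = q),
      (forall p, U p -> {for p, continuous f}) &
      (forall A : set X, open A -> A `<=` U -> open (f @` A))].

Definition is_chart (R : realType) (n : nat) (X : topologicalType)
    (c : chart R n X) : Prop :=
  open_homeo c.1 (c.2 : X -> ('rV[R[i]]_n : normedModType R[i])).

Definition compatible (R : realType) (n : nat) (X : topologicalType)
    (c d : chart R n X) : Prop :=
  forall p, c.1 p -> d.1 p ->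
    holo_in_chart c.2 d.2 p /\ holo_in_chart d.2 c.2 p.

Record complexManifold (R : realType) (n : nat) := ComplexManifold {
  mcarrier :> topologicalType;
  atlas : set (chart R n mcarrier);
  mhausdorff : hausdorff_space mcarrier;
  atlas_chart : forall c, atlas c -> is_chart c;
  atlas_cover : forall p, exists2 c, atlas c & c.1 p;
  atlas_compat : forall c d, atlas c -> atlas d -> compatible c d }.

(* membership in the maximal atlas *)
Definition admissible (R : realType) (n : nat) (X : complexManifold R n)
    (c : chart R n X) : Prop :=
  is_chart c /\ (forall d, atlas d -> compatible c d).

Definition holomorphic_on (R : realType) (n : nat) (X : complexManifold R n)
    (W : normedModType R[i]) (U : set X) (g : X -> W) : Prop :=
  forall c p, @atlas R n X c -> c.1 p -> U p -> holo_in_chart c.2 g p.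

Definition holomorphic_map_on (R : realType) (m n : nat)
    (Y : complexManifold R m) (X : complexManifold R n)
    (U : set Y) (f : Y -> X) : Prop :=
  (forall p, U p -> {for p, continuous f}) /\
  (forall c, @atlas R n X c ->
     holomorphic_on (U `&` f @^-1` c.1) (fun p => c.2 (f p))).

(* a chart in which [Z] is the coordinate subspace x_0 = ... = x_(r-1) = 0 *)
Definition adapted_chart (R : realType) (n : nat) (X : complexManifold R n)
    (Z : set X) (r : nat) (c : chart R n X) : Prop :=
  [/\ admissible c, (r <= n)%N &
      forall p, c.1 p ->
        (Z p <-> forall i : 'I_n, (i < r)%N -> c.2 p 0 i = 0)].

Definition closed_submanifold (R : realType) (n : nat)
    (X : complexManifold R n) (Z : set X) (r : nat) : Prop :=
  closed Z /\ (forall z, Z z -> exists2 c, adapted_chart Z r c & c.1 z).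

(** * Blow-ups *)

(* Points of P^(r-1) are given by homogeneous coordinates [k <> 0]. *)
Definition same_line (R : realType) (r : nat) (k k' : 'rV[R[i]]_r) : Prop :=
  exists2 a : R[i], a != 0 & k = a *: k'.

(* (x, [k]) lies in {x_i k_j = x_j k_i for i, j < r}, a subset of
   C^n x P^(r-1) *)
Definition incident (R : realType) (n r : nat) (rn : (r <= n)%N)
    (x : 'rV[R[i]]_n) (k : 'rV[R[i]]_r) : Prop :=
  k != 0 /\
  (forall i j : 'I_r,
     x 0 (widen_ord rn i) * k 0 j = x 0 (widen_ord rn j) * k 0 i).

(* The standard affine coordinates on the part k_j <> 0 of the incidence
   variety: k_i / k_j for i < r, i <> j; x_j in position j; x_i for i >= r. *)
Definition affine_coord (R : realType) (n r : nat) (j : 'I_r)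
    (x : 'rV[R[i]]_n) (k : 'rV[R[i]]_r) : 'rV[R[i]]_n :=
  \row_(i < n)
    match (insub (i : nat) : option 'I_r) with
    | Some i' => if i' == j then x 0 i else k 0 i' / k 0 j
    | None => x 0 i
    end.

(* In the adapted chart [c], [p |-> (c (pi p), [k p])] identifies the part of
   [Xt] over the domain of [c] with the incidence variety over the image of
   [c], as complex manifolds over [X]: it is a bijection, and the standard
   affine coordinates are charts of [Xt]. *)
Definition blowup_over_chart (R : realType) (n : nat)
    (X Xt : complexManifold R n) (r : nat) (pi : Xt -> X)
    (c : chart R n X) : Prop :=
  exists (rn : (r <= n)%N) (k : Xt -> 'rV[R[i]]_r),
    [/\ (forall p, c.1 (pi p) -> incident rn (c.2 (pi p)) (k p)),
        (forall p q, c.1 (pi p) -> pi p = pi q -> same_line (k p) (k q) ->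
           p = q),
        (forall y l, c.1 y -> incident rn (c.2 y) l ->
           exists2 p, pi p = y & same_line (k p) l) &
        (forall j : 'I_r,
           admissible ([set p | c.1 (pi p) /\ k p 0 j != 0],
                       fun p => affine_coord j (c.2 (pi p)) (k p)))].

(* [pi] is biholomorphic over the complement of [Z], and over a neighbourhood
   of each point of [Z] it is the blow-up of a coordinate subspace. *)
Record is_blowup (R : realType) (n : nat) (X Xt : complexManifold R n)
    (Z : set X) (r : nat) (pi : Xt -> X) : Prop := IsBlowup {
  blowup_holo : holomorphic_map_on setT pi;
  blowup_off : exists g : X -> Xt,
    [/\ (forall x, ~ Z x -> pi (g x) = x),
        (forall p, ~ Z (pi p) -> g (pi p) = p) &
        holomorphic_map_on (~` Z) g];
  blowup_on : forall z, Z z ->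
    exists c, [/\ adapted_chart Z r c, c.1 z & blowup_over_chart r pi c] }.

(** * Line bundles and their volume *)

(* A holomorphic line bundle given by transition functions over an open cover:
   a section is a family with [s i = ltr i j * s j] on overlaps. *)
Record lineBundle (R : realType) (n : nat) (X : complexManifold R n) :=
  LineBundle {
    lidx : Type;
    ldom : lidx -> set X;
    ltr : lidx -> lidx -> X -> R[i] }.

Definition lb_power (R : realType) (n : nat) (X : complexManifold R n)
    (L : lineBundle X) (m : nat) : lineBundle X :=
  @LineBundle R n X (lidx L) (@ldom R n X L) (fun i j x => ltr i j x ^+ m).

(* The local representatives of a section are extended by 0 outside the
   trivialising open sets, so that H0 is a linear subspace of a function
   space. *)
Definition H0 (R : realType) (n : nat) (X : complexManifold R n)
    (L : lineBundle X) : set (lidx L -> X -> R[i]^o) :=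
  [set s : lidx L -> X -> R[i]^o |
          [/\ (forall i, holomorphic_on (ldom i) (s i)),
              (forall i x, ~ ldom i x -> s i x = 0) &
              (forall i j x, ldom i x -> ldom j x ->
                 s i x = ltr i j x * (s j x : R[i]))]].
Arguments H0 {R n X} L.

(* dimension of a linear subspace, as the supremum of the sizes of its
   linearly independent families (possibly +oo) *)
Definition dimension (R : realType) (V : lmodType R[i]) (A : set V) : \bar R :=
  ereal_sup [set (d%:R)%:E | d in [set d : nat |
    exists v : 'I_d -> V, (forall k, A (v k)) /\
      (forall a : 'I_d -> R[i], \sum_(k < d) a k *: v k = 0 ->
         forall k, a k = 0)]].

Definition h0 (R : realType) (n : nat) (X : complexManifold R n)
    (L : lineBundle X) : \bar R := dimension (H0 L).

Definition vol (R : realType) (n : nat) (X : complexManifold R n)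
    (L : lineBundle X) : \bar R :=
  limn_esup (fun m : nat =>
    (h0 (lb_power L m) * ((m%:R ^+ n / (n`!)%:R)^-1)%:E)%E).

(** * Divisors *)

(* Local data of a Cartier divisor: on [ddom i] the local equation is the
   meromorphic function [f_i = dnum i / dden i], and [dtr i j] is the unit
   [f_i / f_j] on overlaps.  See [is_divisor] for the conditions. *)
Record divisor (R : realType) (n : nat) (X : complexManifold R n) := Divisor {
  didx : Type;
  ddom : didx -> set X;
  dnum : didx -> X -> R[i];
  dden : didx -> X -> R[i];
  dtr : didx -> didx -> X -> R[i] }.

(* a holomorphic function on [U] that is not a zero divisor on any open
   subset *)
Definition regular_function (R : realType) (n : nat) (X : complexManifold R n)
    (U : set X) (g : X -> R[i]) : Prop :=
  holomorphic_on U (g : X -> R[i]^o) /\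
  (forall A : set X, open A -> A `<=` U -> A !=set0 ->
     exists2 x, A x & g x != 0).

Record is_divisor (R : realType) (n : nat) (X : complexManifold R n)
    (D : divisor X) : Prop := IsDivisor {
  div_open : forall i : didx D, open (ddom i);
  div_cover : forall x, exists i : didx D, ddom i x;
  div_num : forall i : didx D, regular_function (ddom i) (dnum i);
  div_den : forall i : didx D, regular_function (ddom i) (dden i);
  div_tr : forall i j : didx D,
    holomorphic_on (ddom i `&` ddom j) (dtr i j : X -> R[i]^o);
  div_unit : forall (i j : didx D) x, ddom i x -> ddom j x ->
    dtr i j x != 0 /\
    dnum i x * dden j x = dtr i j x * (dnum j x * dden i x) }.

(* the line bundle O_X(D), with transition functions f_i / f_j *)
Definition line_bundle_of (R : realType) (n : nat) (X : complexManifold R n)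
    (D : divisor X) : lineBundle X :=
  @LineBundle R n X (didx D) (@ddom R n X D) (@dtr R n X D).

Definition div_vol (R : realType) (n : nat) (X : complexManifold R n)
    (D : divisor X) : \bar R := vol (line_bundle_of D).

Definition div_pullback (R : realType) (m n : nat) (Y : complexManifold R m)
    (X : complexManifold R n) (f : Y -> X) (D : divisor X) : divisor Y :=
  @Divisor R m Y (didx D) (fun i => f @^-1` ddom i)
    (fun i p => dnum i (f p)) (fun i p => dden i (f p))
    (fun i j p => dtr i j (f p)).

Definition div_zero (R : realType) (n : nat) (X : complexManifold R n) :
    divisor X :=
  @Divisor R n X unit (fun=> setT) (fun _ _ => 1) (fun _ _ => 1)
    (fun _ _ _ => 1).

Definition div_add (R : realType) (n : nat) (X : complexManifold R n)
    (D E : divisor X) : divisor X :=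
  @Divisor R n X (didx D * didx E) (fun i => ddom i.1 `&` ddom i.2)
    (fun i x => dnum i.1 x * dnum i.2 x) (fun i x => dden i.1 x * dden i.2 x)
    (fun i j x => dtr i.1 j.1 x * dtr i.2 j.2 x).

(* z D has local equations f_i ^ z; a negative z exchanges numerator and
   denominator *)
Definition div_scale (R : realType) (n : nat) (X : complexManifold R n)
    (z : int) (D : divisor X) : divisor X :=
  @Divisor R n X (didx D) (@ddom R n X D)
    (fun i x => (if 0 <= z then dnum i x else dden i x) ^+ `|z|%N)
    (fun i x => (if 0 <= z then dden i x else dnum i x) ^+ `|z|%N)
    (fun i j x => dtr i j x ^ z).

(** * Q-divisors *)

(* the formal finite sum of the q D, for (q, D) in the list *)
Definition qdivisor (R : realType) (n : nat) (X : complexManifold R n) : Type :=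
  seq (rat * divisor X).

Definition is_qdivisor (R : realType) (n : nat) (X : complexManifold R n)
    (D : qdivisor X) : Prop :=
  foldr (fun (t : rat * divisor X) P => is_divisor t.2 /\ P) True D.

Definition qdiv_pullback (R : realType) (m n : nat) (Y : complexManifold R m)
    (X : complexManifold R n) (f : Y -> X) (D : qdivisor X) : qdivisor Y :=
  [seq (t.1, div_pullback f t.2) | t <- D].

(* a D is integral *)
Definition clears (R : realType) (n : nat) (X : complexManifold R n)
    (a : nat) (D : qdivisor X) : bool :=
  all (fun t : rat * divisor X => a%:R * t.1 \is a Num.int) D.

(* the integral divisor a D, meaningful when [clears a D]: then each
   [numq (a%:R * q)] is the integer [a%:R * q] itself *)
Definition qdiv_multiple (R : realType) (n : nat) (X : complexManifold R n)
    (a : nat) (D : qdivisor X) : divisor X :=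
  foldr (fun (t : rat * divisor X) E =>
           div_add (div_scale (numq (a%:R * t.1)) t.2) E) (div_zero X) D.

(* vol(D) computed with the multiple a D *)
Definition qdiv_vol (R : realType) (n : nat) (X : complexManifold R n)
    (a : nat) (D : qdivisor X) : \bar R :=
  (((a%:R ^+ n)^-1)%:E * div_vol (qdiv_multiple a D))%E.

(* Main.v *)
Require Import Defs.
From HB Require Import structures.
From mathcomp Require Import ring lra.
Import Order.TTheory GRing.Theory Num.Theory numFieldNormedType.Exports.
Import Normc ComplexField.
Set Implicit Arguments.
Unset Strict Implicit.
Unset Printing Implicit Defensive.
Local Open Scope classical_set_scope.
Local Open Scope complex_scope.
Local Open Scope ring_scope.

(* Pulling back sections along the surjection [pi] is injective, so it suffices
   that every section of [pi^* L] descends to [X]. Off [Z] it descends through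
   the inverse of [pi]. Near a point of [Z], the function obtained off [Z] is
   holomorphic outside a coordinate subspace of codimension at least 2, hence
   extends by Hartogs' theorem, and the pullback of the extension agrees with
   the given section on the exceptional divisor because that divisor has empty
   interior.

   For Hartogs' theorem, the extension is the average of the translates
   [x |-> f (x + r e^(it) e_0)] over the circle. It agrees with [f] off [Z] by
   the mean value property, and it is differentiable because Cauchy estimates
   make the first order Taylor remainder of [f] uniformly quadratic along the
   circle. Complex differentiability is only pointwise here, so the mean value
   property is derived from Goursat's bisection argument, applied to
   [(s, t) |-> f (e^(s + it))] on a rectangle of height [2 pi]. *)

Local Arguments normc : simpl never.

(** * Integrals of complex-valued functions of a real variable *)

Section Normc.
Context {R : realType}.
Implicit Types z w : R[i].

(** The norm of [R[i]] takes its values in [R[i]] itself; [normc] is its real form, so that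
    estimates can be carried out in [R]. *)
Lemma normcE z : `|z| = (normc z)%:C.
Proof. by case: z. Qed.

Lemma normc_ge0 z : 0 <= normc z.
Proof. by rewrite -ler0c -normcE normr_ge0. Qed.

Lemma normcD z w : normc (z + w) <= normc z + normc w.
Proof. by rewrite -lecR rmorphD -!normcE ler_normD. Qed.

Lemma normcB z w : normc (z - w) <= normc z + normc w.
Proof. by rewrite -lecR rmorphD -!normcE ler_normB. Qed.

Lemma normc_real (x : R) : normc x%:C = `|x|.
Proof. by rewrite /normc /= expr0n addr0 sqrtr_sqr. Qed.

Lemma normc_distC z w : normc (z - w) = normc (w - z).
Proof. by rewrite -normcN opprB. Qed.

Lemma normc_eq0 z : (normc z == 0) = (z == 0).
Proof. by apply/eqP/eqP => [/eq0_normc//|->]; rewrite normc0. Qed.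

Lemma normc_gt0 z : (0 < normc z) = (z != 0).
Proof. by rewrite lt_neqAle normc_ge0 andbT eq_sym normc_eq0. Qed.

Lemma normc_Re z : `|complex.Re z| <= normc z.
Proof. by rewrite -lecR -normcE normc_ge_Re. Qed.

Lemma normc_i : normc ('i : R[i]) = 1.
Proof. by rewrite /normc /= expr0n expr1n add0r sqrtr1. Qed.

Lemma normc_Im z : `|complex.Im z| <= normc z.
Proof.
rewrite -[normc z]mul1r -normc_i mulrC -normcM; apply: le_trans (normc_Re _).
by rewrite ReiNIm normrN.
Qed.

Lemma normc_le z : normc z <= `|complex.Re z| + `|complex.Im z|.
Proof.
rewrite {1}[z]complexE (le_trans (normcD _ _))// normcM normc_i mul1r.
by rewrite !normc_real.
Qed.

Lemma normc_small_eq0 z : (forall e : R, 0 < e -> normc z <= e) -> z = 0.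
Proof.
move=> H; apply: contrapT => /eqP; rewrite -normc_gt0 => z0.
have := H (normc z / 2) ltac:(by rewrite divr_gt0).
by rewrite leNgt ltr_pdivrMr// ltr_pMr// ltr1n.
Qed.

End Normc.

(** * Continuity and componentwise integration *)

Section Integral.
Context {R : realType}.
Local Notation mu := (@lebesgue_measure R).
Implicit Types (g h : R -> R[i]) (a b : R).

(** Continuity at [x], phrased with the real modulus so that it combines directly with the estimates
    on [normc]. *)
Definition ccont g x : Prop :=
  forall e : R, 0 < e -> \forall y \near x, normc (g y - g x) <= e.

Definition cint a b g : R[i] :=
  (Rintegral mu `[a, b] (fun x => complex.Re (g x))) +i*
  (Rintegral mu `[a, b] (fun x => complex.Im (g x))).

Lemma ccont_cst k x : ccont (fun=> k) x.
Proof. by move=> e e0; near=> y; rewrite subrr normc0 ltW. Unshelve. all: by end_near. Qed.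

Lemma ccontD g h x : ccont g x -> ccont h x -> ccont (fun y => g y + h y) x.
Proof.
move=> cg ch e e0; have e2 : 0 < e / 2 by rewrite divr_gt0.
near=> y; rewrite opprD addrACA (le_trans (normcD _ _))// [e]splitr lerD//.
by near: y; exact: cg. by near: y; exact: ch.
Unshelve. all: by end_near. Qed.

Lemma ccontZ (k : R[i]) g x : ccont g x -> ccont (fun y => k * g y) x.
Proof.
move=> cg e e0; have k0 : 0 < normc k + 1 by rewrite ltr_wpDl ?normc_ge0.
near=> y; rewrite -mulrBr normcM.
have : normc (g y - g x) <= e / (normc k + 1).
  by near: y; apply: cg; rewrite divr_gt0.
move=> /(ler_wpM2l (normc_ge0 k)) /le_trans; apply.
by rewrite mulrCA ler_piMr ?ltW// ltr_pdivrMr// mul1r ltrDl.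
Unshelve. all: by end_near. Qed.

Lemma ccontB g h x : ccont g x -> ccont h x -> ccont (fun y => g y - h y) x.
Proof.
move=> cg /(@ccontZ (-1)) ch; have := ccontD cg ch.
by under eq_fun do rewrite mulN1r.
Qed.

Lemma ccont_Re g x : ccont g x -> {for x, continuous (fun y => complex.Re (g y))}.
Proof.
move=> cg; apply/cvgrPdist_le => e e0; near=> y.
rewrite -raddfB /= -normrN -raddfN opprB (le_trans (normc_Re _))//.
by near: y; exact: cg.
Unshelve. all: by end_near. Qed.

Lemma ccont_Im g x : ccont g x -> {for x, continuous (fun y => complex.Im (g y))}.
Proof.
move=> cg; apply/cvgrPdist_le => e e0; near=> y.
rewrite -raddfB /= -normrN -raddfN opprB (le_trans (normc_Im _))//.
by near: y; exact: cg.
Unshelve. all: by end_near. Qed.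

Lemma integrable_itv a b (f : R -> R) :
  (forall x, a <= x <= b -> {for x, continuous f}) ->
  mu.-integrable `[a, b] (EFin \o f).
Proof.
move=> cf; apply: continuous_compact_integrable; first exact: segment_compact.
apply: continuous_in_subspaceT => x; rewrite inE /= in_itv /= => xab.
exact: cf.
Qed.

Definition ccont_on a b g := forall x, a <= x <= b -> ccont g x.

Let int_Re a b g : ccont_on a b g ->
  mu.-integrable `[a, b] (EFin \o (fun x => complex.Re (g x))).
Proof. by move=> cg; apply: integrable_itv => x /cg /ccont_Re. Qed.

Let int_Im a b g : ccont_on a b g ->
  mu.-integrable `[a, b] (EFin \o (fun x => complex.Im (g x))).
Proof. by move=> cg; apply: integrable_itv => x /cg /ccont_Im. Qed.

Lemma cint_cst a b k : a <= b -> cint a b (fun=> k) = (b - a)%:C * k.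
Proof.
move=> ab; rewrite /cint !Rintegral_cst//= lebesgue_measure_itv/= lte_fin.
have -> : fine (if a < b then (b%:E - a%:E)%E else 0%E) = b - a.
  by case: ltP => //= ba; apply/esym/eqP; rewrite subr_eq0 eq_le ab ba.
by case: k => x y; rewrite [_%:C * _]/= /=; congr (_ +i* _); rewrite /= ?mul0r; ring.
Qed.

Lemma cintD a b g h : ccont_on a b g -> ccont_on a b h ->
  cint a b (fun x => g x + h x) = cint a b g + cint a b h.
Proof.
move=> cg ch; rewrite /cint.
under eq_Rintegral do rewrite raddfD/=.
rewrite RintegralD//=; [|exact: int_Re..].
under [X in _ +i* X = _]eq_Rintegral do rewrite raddfD/=.
by rewrite RintegralD//=; exact: int_Im.
Qed.

Lemma cintZ a b k g : ccont_on a b g ->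
  cint a b (fun x => k * g x) = k * cint a b g.
Proof.
move=> cg; rewrite /cint.
have iR r : mu.-integrable `[a, b] (EFin \o (fun x => r * complex.Re (g x))).
  apply: integrable_itv => x xab.
  by apply: continuousM; [exact: cst_continuous|exact/ccont_Re/cg].
have iI r : mu.-integrable `[a, b] (EFin \o (fun x => r * complex.Im (g x))).
  apply: integrable_itv => x xab.
  by apply: continuousM; [exact: cst_continuous|exact/ccont_Im/cg].
case: k => k l; rewrite [RHS]/=.
under eq_Rintegral => x _.
  rewrite (_ : complex.Re _ = k * complex.Re (g x) - l * complex.Im (g x)); last by case: (g x).
  over.
under [X in _ +i* X = _]eq_Rintegral => x _.
  rewrite (_ : complex.Im _ = k * complex.Im (g x) + l * complex.Re (g x)); last by case: (g x).
  over.
rewrite RintegralB// RintegralD// !RintegralZl//; do ?[exact: int_Re|exact: int_Im].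
Qed.

Lemma cintB a b g h : ccont_on a b g -> ccont_on a b h ->
  cint a b (fun x => g x - h x) = cint a b g - cint a b h.
Proof.
move=> cg ch; rewrite -mulN1r -cintZ// -cintD//.
  by congr cint; apply/funext => x; rewrite mulN1r.
by move=> x xab; apply/ccontZ/ch.
Qed.

Lemma eq_cint a b g h : (forall x, a <= x <= b -> g x = h x) ->
  cint a b g = cint a b h.
Proof.
by move=> gh; rewrite /cint; congr (_ +i* _); apply: eq_Rintegral => x;
  rewrite inE /= in_itv /= => /gh ->.
Qed.

(* The factor 2 comes from bounding the real and imaginary parts separately. *)
Lemma normc_cint_le a b g (k : R) : a <= b -> ccont_on a b g ->
  (forall x, a <= x <= b -> normc (g x) <= k) ->
  normc (cint a b g) <= 2 * k * (b - a).
Proof.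
move=> ab cg gk.
have bnd (f : R -> R) : (forall x, a <= x <= b -> {for x, continuous f}) ->
    (forall x, a <= x <= b -> `|f x| <= k) ->
    `|Rintegral mu `[a, b] f| <= k * (b - a).
  move=> cf fk; have fi := integrable_itv cf.
  apply: (le_trans (le_normr_Rintegral _ fi)) => //.
  have -> : k * (b - a) = Rintegral mu `[a, b] (fun=> k).
    have := cint_cst k%:C ab => -[+ _]; rewrite -(mulrC (b - a)) => -> /=.
    by rewrite mulr0 subr0.
  apply: le_Rintegral => //.
    by apply: integrable_itv => x /cf /cvg_norm.
  by apply: integrable_itv => x _; exact: cst_continuous.
apply: le_trans (normc_le _) _; rewrite -mulrA mulr_natl mulr2n lerD//=.
  apply: bnd => x xab; first exact/ccont_Re/cg.
  by rewrite (le_trans (normc_Re _))// gk.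
apply: bnd => x xab; first exact/ccont_Im/cg.
by rewrite (le_trans (normc_Im _))// gk.
Qed.

Lemma cint_chasles a b c g : a <= b -> b <= c -> ccont_on a c g ->
  cint a c g = cint a b g + cint b c g.
Proof.
move=> ab bc cg.
have ch (f : R -> R) : (forall x, a <= x <= c -> {for x, continuous f}) ->
    Rintegral mu `[a, c] f = Rintegral mu `[a, b] f + Rintegral mu `[b, c] f.
  move=> cf; have fi := integrable_itv cf.
  apply/eqP; rewrite addrC -subr_eq; apply/eqP.
  (* The difference is an integral over the half-open interval from [b] to [c]; adding the endpoint
     [b] does not change it. *)
  rewrite (Rintegral_itvB fi) ?bnd_simp//; apply: Rintegral_itv_obnd_cbnd.
  apply: integrableS fi => // x /=; rewrite !in_itv/= => /andP[bx ->].
  by rewrite (le_trans ab (ltW bx)).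
rewrite /cint; rewrite (ch (fun x => complex.Re (g x)))//; last first.
  by move=> x /cg /ccont_Re.
rewrite (ch (fun x => complex.Im (g x)))//.
by move=> x /cg /ccont_Im.
Qed.

End Integral.

(** * Goursat's theorem on rectangles *)

Section Goursat.
Context {R : realType}.
Implicit Types (h : R -> R -> R[i]) (a b c d x y : R).

(** Complex differentiability at [x + iy] of a function of two real variables: the linear part is
    multiplication by one complex number [l], which encodes the Cauchy-Riemann equations. *)
Definition cdiff2 h x y : Prop := exists l : R[i], forall e : R, 0 < e ->
  exists2 r : R, 0 < r & forall u v, `|u| < r -> `|v| < r ->
    normc (h (x + u) (y + v) - h x y - l * (u +i* v)) <= e * (`|u| + `|v|).

Lemma cdiff2_near h x y e : cdiff2 h x y -> 0 < e ->
  exists2 r : R, 0 < r & forall u v, `|u| < r -> `|v| < r ->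
    normc (h (x + u) (y + v) - h x y) <= e.
Proof.
move=> [l /(_ 1 ltr01)[r r0 hr]] e0.
have k0 : 0 < 2 + 2 * normc l by rewrite ltr_wpDr// mulr_ge0// normc_ge0.
exists (Num.min r (e / (2 + 2 * normc l))); first by rewrite lt_min r0 divr_gt0.
move=> u v; rewrite !lt_min => /andP[ur ue] /andP[vr ve].
have -> : h (x + u) (y + v) - h x y =
  (h (x + u) (y + v) - h x y - l * (u +i* v)) + l * (u +i* v) by ring.
apply: le_trans (normcD _ _) _; rewrite normcM.
apply: (@le_trans _ _ ((1 + normc l) * (`|u| + `|v|))).
  rewrite mulrDl; apply: lerD; first exact: hr.
  by apply: ler_wpM2l; [exact: normc_ge0|exact: (normc_le (u +i* v))].
rewrite -ler_pdivlMl; last by rewrite ltr_wpDr// normc_ge0.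
rewrite !ltr_pdivlMr// in ue ve.
rewrite mulrC ler_pdivlMr; last by rewrite ltr_wpDr// normc_ge0.
lra.
Qed.

Lemma cdiff2_ccontx h x y : cdiff2 h x y -> ccont (h ^~ y) x.
Proof.
move=> hd e e0; have [r r0 hr] := cdiff2_near hd e0.
near=> z; have := hr (z - x) 0; rewrite subrKC addr0 normr0.
by apply => //; near: z; near_simpl; exact: nbhsx_ballx.
Unshelve. all: by end_near. Qed.

Lemma cdiff2_cconty h x y : cdiff2 h x y -> ccont (h x) y.
Proof.
move=> hd e e0; have [r r0 hr] := cdiff2_near hd e0.
near=> z; have := hr 0 (z - y); rewrite subrKC addr0 normr0.
by apply => //; near: z; near_simpl; exact: nbhsx_ballx.
Unshelve. all: by end_near. Qed.

(* The boundary integral of a rectangle, with opposite sides grouped so that an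
   affine [h] only leads to integrals of constants. *)
Definition rect_int h a b c d : R[i] :=
  cint a b (fun x => h x c - h x d) + 'i * cint c d (fun y => h b y - h a y).

Local Arguments rect_int : simpl never.

Definition cdiff2_on h a b c d :=
  forall x y, a <= x <= b -> c <= y <= d -> cdiff2 h x y.

Lemma cdiff2_on_sub h a b c d a' b' c' d' : a <= a' -> b' <= b -> c <= c' ->
  d' <= d -> cdiff2_on h a b c d -> cdiff2_on h a' b' c' d'.
Proof.
move=> aa bb cc dd H x y /andP[ax xb] /andP[cy yd]; apply: H.
  by rewrite (le_trans aa)//= (le_trans xb).
by rewrite (le_trans cc)//= (le_trans yd).
Qed.

Let cx h a b c d y : cdiff2_on h a b c d -> c <= y <= d ->
  ccont_on a b (h ^~ y).
Proof. by move=> H yd x xab; exact/cdiff2_ccontx/H. Qed.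

Let cy h a b c d x : cdiff2_on h a b c d -> a <= x <= b -> ccont_on c d (h x).
Proof. by move=> H xab y yd; exact/cdiff2_cconty/H. Qed.

(** The two integrals along the common side [x = m] cancel. *)
Lemma rect_int_splitx h a m b c d : a <= m -> m <= b -> c <= d ->
  cdiff2_on h a b c d ->
  rect_int h a b c d = rect_int h a m c d + rect_int h m b c d.
Proof.
move=> am mb cd H; rewrite /rect_int addrACA -mulrDr; congr (_ + _ * _).
  apply: cint_chasles => // x xab; apply: ccontB.
    by apply: (cx H) => //; rewrite lexx.
  by apply: (cx H) => //; rewrite lexx cd.
have ab := le_trans am mb.
rewrite -cintD; first by apply: eq_cint => y _; ring.
  by move=> y ycd; apply: ccontB; apply: (cy H) => //; rewrite ?am ?lexx.
by move=> y ycd; apply: ccontB; apply: (cy H) => //; rewrite ?am ?lexx ?ab.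
Qed.

Lemma rect_int_splity h a b c m d : c <= m -> m <= d -> a <= b ->
  cdiff2_on h a b c d ->
  rect_int h a b c d = rect_int h a b c m + rect_int h a b m d.
Proof.
move=> cm md ab H; rewrite /rect_int addrACA -mulrDr; congr (_ + _ * _).
  have cd := le_trans cm md.
  rewrite -cintD; first by apply: eq_cint => x _; ring.
    by move=> x xab; apply: ccontB; apply: (cx H) => //; rewrite ?cm ?lexx.
  by move=> x xab; apply: ccontB; apply: (cx H) => //; rewrite ?cm ?lexx ?cd.
apply: cint_chasles => // y ycd; apply: ccontB.
  by apply: (cy H) => //; rewrite lexx ab.
by apply: (cy H) => //; rewrite lexx.
Qed.

(** An affine function of [s + it] has zero boundary integral, so only the deviation of [h] from it
    counts. The difference of [h] between opposite sides deviates by at most [2 * e], and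
    [normc_cint_le] doubles this. *)
Lemma rect_int_le h a b c d (z l : R[i]) (x y e : R) :
  a <= b -> c <= d -> cdiff2_on h a b c d ->
  (forall s t, a <= s <= b -> c <= t <= d ->
    normc (h s t - z - l * ((s - x) +i* (t - y))) <= e) ->
  normc (rect_int h a b c d) <= 4 * e * ((b - a) + (d - c)).
Proof.
move=> ab cd H he.
have aab : a <= a <= b by rewrite lexx.
have bab : a <= b <= b by rewrite lexx ab.
have ccd : c <= c <= d by rewrite lexx.
have dcd : c <= d <= d by rewrite lexx cd.
have -> : rect_int h a b c d =
  cint a b (fun s => (h s c - h s d) - l * (0 +i* (c - d))) +
  'i * cint c d (fun t => (h b t - h a t) - l * (b - a)%:C).
  have cX y' : c <= y' <= d -> ccont_on a b (h ^~ y') by exact: cx H.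
  have cY x' : a <= x' <= b -> ccont_on c d (h x') by exact: cy H.
  rewrite cintB; last by move=> *; exact: ccont_cst.
    rewrite [X in _ + 'i * X]cintB; last by move=> *; exact: ccont_cst.
      rewrite !cint_cst// /rect_int mulrBr addrACA -opprD.
      rewrite [X in _ = _ - X](_ : _ = 0) ?subr0//.
      have -> : 0 +i* (c - d) = 'i * (c - d)%:C by rewrite [RHS]complexE /=; simpc.
      by rewrite !rmorphB; ring.
    by move=> y' ycd; apply: ccontB; [exact: cY bab _ ycd|exact: cY aab _ ycd].
  by move=> x' xab; apply: ccontB; [exact: cX ccd _ xab|exact: cX dcd _ xab].
(* Both values lie within [e] of the same affine function. *)
have ii s t s' t' : a <= s <= b -> c <= t <= d -> a <= s' <= b -> c <= t' <= d ->
   normc (h s t - h s' t' - l * ((s - s') +i* (t - t'))) <= 2 * e.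
  move=> sab tcd sab' tcd'.
  have -> : h s t - h s' t' - l * ((s - s') +i* (t - t')) =
    (h s t - z - l * ((s - x) +i* (t - y))) -
    (h s' t' - z - l * ((s' - x) +i* (t' - y))).
    have -> : (s - s') +i* (t - t') = ((s - x) +i* (t - y)) - ((s' - x) +i* (t' - y)).
      by apply/eqP; rewrite eq_complex /=; apply/andP; split; apply/eqP => /=; ring.
    ring.
  by apply: le_trans (normcB _ _) _; rewrite mulr_natl mulr2n lerD// he.
apply: le_trans (normcD _ _) _; rewrite normcM normc_i mul1r mulrDr lerD//.
  rewrite (_ : 4 * e = 2 * (2 * e)); last by ring.
  apply: normc_cint_le => //.
    move=> s sab; apply: ccontB; last exact: ccont_cst.
    by apply: ccontB; exact: (cx H).
  by move=> s sab; have := ii s c s d sab ccd sab dcd; rewrite subrr.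
rewrite (_ : 4 * e = 2 * (2 * e)); last by ring.
apply: normc_cint_le => //.
  move=> s sab; apply: ccontB; last exact: ccont_cst.
  by apply: ccontB; exact: (cy H).
by move=> t tcd; have := ii b t a t bab tcd aab tcd; rewrite subrr.
Qed.

(** The supremum of the left endpoints lies in every interval. *)
Lemma nested_itv (A B : nat -> R) : (forall n, A n <= A n.+1) ->
  (forall n, B n.+1 <= B n) -> (forall n, A n <= B n) ->
  exists x, forall n, A n <= x <= B n.
Proof.
move=> Ai Bd AB.
have Am m n : (m <= n)%N -> A m <= A n.
  elim: n => [|n IH]; first by rewrite leqn0 => /eqP ->.
  rewrite leq_eqVlt => /orP[/eqP->//|]; rewrite ltnS => /IH /le_trans; exact.
have Bm m n : (m <= n)%N -> B n <= B m.
  elim: n => [|n IH]; first by rewrite leqn0 => /eqP ->.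
  rewrite leq_eqVlt => /orP[/eqP->//|]; rewrite ltnS => /IH; exact: le_trans.
have ABm m n : A m <= B n.
  apply: le_trans (Am _ _ (leq_maxl m n)) _.
  exact: le_trans (AB _) (Bm _ _ (leq_maxr m n)).
exists (sup (range A)) => n; apply/andP; split.
  apply: ub_le_sup; last by exists n.
  by exists (B 0%N) => _ [m _ <-].
apply: ge_sup; first by exists (A 0%N), 0%N.
by move=> _ [m _ <-].
Qed.

(** Were the integral nonzero, bisection would give nested rectangles whose integrals stay above
    [kp] times the squared semiperimeter. Near the common point, differentiability bounds the
    integral by that very quantity. *)
Theorem goursat h a b c d : a <= b -> c <= d -> cdiff2_on h a b c d ->
  rect_int h a b c d = 0.
Proof.
move=> ab cd H; apply: contrapT => /eqP; rewrite -normc_gt0 => I0.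
set I := normc _ in I0.
have s0 : 0 < ((b - a) + (d - c)) ^+ 2 + 1 by rewrite ltr_wpDl ?sqr_ge0.
(* The [+ 1] makes the initial inequality strict and avoids a division by zero for a degenerate
   rectangle. *)
set kp := I / (((b - a) + (d - c)) ^+ 2 + 1).
have kp0 : 0 < kp by rewrite divr_gt0.
(* Halving both sides divides the squared semiperimeter by 4, so this property
   passes to one of the four quarters. *)
pose bad (Q : (R * R) * (R * R)) :=
  [/\ a <= Q.1.1 /\ Q.1.2 <= b, c <= Q.2.1 /\ Q.2.2 <= d, Q.1.1 <= Q.1.2,
      Q.2.1 <= Q.2.2 & kp * ((Q.1.2 - Q.1.1) + (Q.2.2 - Q.2.1)) ^+ 2 <
        normc (rect_int h Q.1.1 Q.1.2 Q.2.1 Q.2.2)].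
have bad0 : bad ((a, b), (c, d)).
  split => //=; rewrite -/I /kp -mulrAC ltr_pdivrMr//.
  by rewrite ltr_pM2l// ltrDl.
have step (Q : {Q | bad Q}) : exists Q' : {Q | bad Q},
  [/\ (sval Q).1.1 <= (sval Q').1.1, (sval Q').1.2 <= (sval Q).1.2,
      (sval Q).2.1 <= (sval Q').2.1, (sval Q').2.2 <= (sval Q).2.2 &
      ((sval Q').1.2 - (sval Q').1.1) + ((sval Q').2.2 - (sval Q').2.1) =
      (((sval Q).1.2 - (sval Q).1.1) + ((sval Q).2.2 - (sval Q).2.1)) / 2].
  case: Q => -[[p q] [r s]] /= [/=[ap qb] [cr sd] pq rs hb].
  pose m := (p + q) / 2; pose n := (r + s) / 2.
  have [pm mq] : p <= m /\ m <= q by rewrite /m; split; lra.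
  have [rn ns] : r <= n /\ n <= s by rewrite /n; split; lra.
  have Hpq : cdiff2_on h p q r s by exact: cdiff2_on_sub H.
  suff : exists Q', [/\ bad Q', p <= Q'.1.1 /\ Q'.1.2 <= q,
      r <= Q'.2.1, Q'.2.2 <= s &
      (Q'.1.2 - Q'.1.1) + (Q'.2.2 - Q'.2.1) = ((q - p) + (s - r)) / 2].
    by move=> [Q' [bQ [? ?] ? ? ?]]; exists (exist _ Q' bQ).
  apply: contrapT => no.
  (* If no quarter is bad, each integral is at most [kp] times a quarter of the squared
     semiperimeter, and the four bounds add up to the negation of [hb]. *)
  have small p' q' r' s' : p <= p' -> q' <= q -> r <= r' -> s' <= s ->
      p' <= q' -> r' <= s' -> (q' - p') + (s' - r') = ((q - p) + (s - r)) / 2 ->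
      normc (rect_int h p' q' r' s') <= kp * (((q - p) + (s - r)) / 2) ^+ 2.
    move=> pp qq rr ss pq' rs' E; rewrite leNgt; apply/negP => lt; apply: no.
    exists ((p', q'), (r', s')); split => //=; split => //=.
    - by rewrite (le_trans ap)// (le_trans qq).
    - by rewrite (le_trans cr)// (le_trans ss).
    - by rewrite E.
  have {}hb : kp * (q - p + (s - r)) ^+ 2 < normc (rect_int h p q r s) by exact: hb.
  move: hb; apply/negP; rewrite -leNgt.
  rewrite (rect_int_splitx pm mq rs Hpq).
  rewrite (rect_int_splity rn ns pm (cdiff2_on_sub (lexx _) mq (lexx _) (lexx _) Hpq)).
  rewrite (rect_int_splity rn ns mq (cdiff2_on_sub pm (lexx _) (lexx _) (lexx _) Hpq)).
  apply: le_trans (normcD _ _) _.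
  apply: le_trans (lerD (normcD _ _) (normcD _ _)) _.
  have -> : kp * (q - p + (s - r)) ^+ 2 =
    (kp * (((q - p) + (s - r)) / 2) ^+ 2 + kp * (((q - p) + (s - r)) / 2) ^+ 2)
    + (kp * (((q - p) + (s - r)) / 2) ^+ 2 + kp * (((q - p) + (s - r)) / 2) ^+ 2).
    by field.
  by apply: lerD; apply: lerD; apply: small => //; rewrite /m /n; field.
have [f fP] := choice step.
pose Q n := sval (iter n f (exist _ _ bad0)).
have Qbad n : bad (Q n) by exact: svalP.
have Qs n : ((Q n).1.2 - (Q n).1.1) + ((Q n).2.2 - (Q n).2.1) =
    ((b - a) + (d - c)) / 2 ^+ n.
  elim: n => [|n IH]; first by rewrite expr0 divr1.
  have [_ _ _ _ E] := fP (iter n f (exist _ _ bad0)).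
  rewrite /Q iterS E -/(Q n) IH exprS invfM; ring.
have [x xP] : exists x, forall n, (Q n).1.1 <= x <= (Q n).1.2.
  apply: (@nested_itv (fun n => (Q n).1.1) (fun n => (Q n).1.2)) => n.
  - by have [] := fP (iter n f (exist _ _ bad0)).
  - by have [] := fP (iter n f (exist _ _ bad0)).
  - by have [] := Qbad n.
have [y yP] : exists x, forall n, (Q n).2.1 <= x <= (Q n).2.2.
  apply: (@nested_itv (fun n => (Q n).2.1) (fun n => (Q n).2.2)) => n.
  - by have [] := fP (iter n f (exist _ _ bad0)).
  - by have [] := fP (iter n f (exist _ _ bad0)).
  - by have [] := Qbad n.
have [l hl] := H x y (xP 0%N) (yP 0%N).
(* The 4 compensates the constant of [rect_int_le]. *)
have e0 : 0 < kp / 4 by rewrite divr_gt0.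
have [r r0 hr] := hl _ e0.
have [n sr] : exists n, ((b - a) + (d - c)) / 2 ^+ n < r.
  have k0 : 0 < (b - a) + (d - c) + 1 by rewrite ltr_wpDl// addr_ge0// subr_ge0.
  have rk : 0 < r / ((b - a) + (d - c) + 1) by rewrite divr_gt0.
  have [n _ /(_ n (leqnn n))/=] := near_infty_natSinv_expn_lt (PosNum rk).
  rewrite ltr_pdivlMr// => nr; exists n; apply: le_lt_trans nr.
  by rewrite mul1r [leRHS]mulrC ler_pM2r ?invr_gt0 ?exprn_gt0// lerDl.
have [/= [pa qb] [pc qd] pq rs /lt_geF] := Qbad n.
have := xP n; have := yP n; have := Qs n; move: pa qb pc qd pq rs.
case: (Q n) => -[p q] [u v] /= pa qb pc qd pq rs sE /andP[uy yv] /andP[px xq].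
set s := q - p + (v - u) in sE *; rewrite -sE in sr.
have s_ge0 : 0 <= s by rewrite /s addr_ge0// subr_ge0.
have Hpq : cdiff2_on h p q u v by exact: cdiff2_on_sub H.
suff -> : normc (rect_int h p q u v) <= kp * s ^+ 2 by [].
have -> : kp * s ^+ 2 = 4 * (kp / 4 * s) * s by field.
apply: (@rect_int_le _ _ _ _ _ (h x y) l x y) => // s' t /andP[ps sq] /andP[ut tv].
have xd : `|s' - x| <= q - p by rewrite ler_norml; apply/andP; split; lra.
have yd : `|t - y| <= v - u by rewrite ler_norml; apply/andP; split; lra.
have := hr (s' - x) (t - y); rewrite !subrKC => /(_ _ _)/le_trans; apply.
- by apply: le_lt_trans sr; rewrite (le_trans xd)// lerDl subr_ge0.
- by apply: le_lt_trans sr; rewrite (le_trans yd)// lerDr subr_ge0.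
by rewrite ler_pM2l// lerD.
Qed.
End Goursat.

(** * Circular means and Cauchy estimates *)

Lemma differentiable_near (K : numFieldType) (V W : normedModType K)
    (f : V -> W) (x : V) (e : K) : differentiable f x -> 0 < e ->
  \forall v \near (0 : V), `|f (x + v) - f x - 'd f x v| <= e * `|v|.
Proof.
move=> /diff_locallyxC fE e0.
have /eqaddoP/(_ e e0) : (fun h => f (x + h)) =
    (fun h => f x + 'd f x h) +o_ (0 : V) id by apply/eqaddoE/funext => h; exact: fE.
by apply: filterS => v /=; rewrite [in X in X -> _]/GRing.add /= opprD addrA.
Qed.

(** * Complex derivatives and the exponential map *)

Section OneVariable.
Context {R : realType}.
Local Notation C := (R[i]^o).
Implicit Types (G : C -> C) (z w l : C).

Lemma nbhs_normc (V : normedModType R[i]) (x : V) (P : set V) : (\forall y \near x, P y) ->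
  exists2 r : R, 0 < r & forall y, `|y - x| < r%:C -> P y.
Proof.
move=> /nbhs_ballP[r /= r0 rP].
have rE : (complex.Re r)%:C = r by apply: RRe_real; apply: gtr0_real.
exists (complex.Re r) => [|y yr]; first by rewrite -ltcR rE.
by apply: rP; rewrite -ball_normE /= distrC -rE.
Qed.

Definition cdiff G z l := forall e : R, 0 < e -> exists2 r : R, 0 < r &
  forall w, normc w < r -> normc (G (z + w) - G z - l * w) <= e * normc w.

Lemma derivable_cdiff G z : derivable G z 1 -> cdiff G z ('D_1 G z).
Proof.
move=> /derivable1_diffP dG e e0.
have e0' : 0 < e%:C by rewrite ltcR.
have [r r0 rP] := nbhs_normc (differentiable_near dG e0').
exists r => // w wr; have := rP w; rewrite subr0 normcE ltcR => /(_ wr).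
rewrite !normcE -rmorphM lecR => H; apply: le_trans H.
rewrite le_eqVlt; apply/orP; left; apply/eqP; congr (normc (_ - _)).
rewrite -[w in RHS]mulr1 [RHS](_ : _ = 'd G z (w *: 1))// linearZ /= mulrC.
by rewrite deriveE.
Qed.

Lemma cdiff_cont G z l e : cdiff G z l -> 0 < e ->
  exists2 r : R, 0 < r & forall w, normc w < r -> normc (G (z + w) - G z) <= e.
Proof.
move=> /(_ 1 ltr01)[r r0 hr] e0.
have k0 : 0 < 1 + normc l by rewrite ltr_pwDl// normc_ge0.
exists (Num.min r (e / (1 + normc l))); first by rewrite lt_min r0 divr_gt0.
move=> w; rewrite lt_min => /andP[wr we].
rewrite -[G _ - _](subrK (l * w)) (le_trans (normcD _ _))// normcM.
apply: (@le_trans _ _ ((1 + normc l) * normc w)).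
  by rewrite mulrDl lerD// hr.
by rewrite mulrC -ler_pdivlMr// ltW.
Qed.

(** The chain rule: the error is that of [G] at the increment [W], plus [l] times the error of [k];
    each takes half of [e]. *)
Lemma cdiff2_comp G (k : R -> R -> R[i]) x y l : cdiff2 k x y -> cdiff G (k x y) l ->
  cdiff2 (fun s t => G (k s t)) x y.
Proof.
move=> [m km] dG; exists (l * m) => e e0.
have l0 : 0 < 1 + normc l by rewrite ltr_pwDl// normc_ge0.
have m0 : 0 < 1 + normc m by rewrite ltr_pwDl// normc_ge0.
have e'0 : 0 < e / (2 * (1 + normc m)) by rewrite divr_gt0// mulr_gt0.
have [r2 r20 hr2] := dG _ e'0.
(* The cap 1 bounds [W] by [(1 + normc m) * (|u| + |v|)]; the other term controls the error of [k]
   after multiplication by [l]. *)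
pose n := Num.min 1 (e / (2 * (1 + normc l))).
have n0 : 0 < n by rewrite lt_min ltr01 divr_gt0// mulr_gt0.
have [r1 r10 hr1] := km _ n0.
exists (Num.min r1 (r2 / (2 * (1 + normc m)))).
  by rewrite lt_min r10 divr_gt0// mulr_gt0.
move=> u v; rewrite !lt_min => /andP[ur1 ur2] /andP[vr1 vr2].
have := hr1 u v ur1 vr1; set W := k _ _ - k x y => hW.
have W1 : normc W <= (1 + normc m) * (`|u| + `|v|).
  rewrite -[W](subrK (m * (u +i* v))) (le_trans (normcD _ _))// mulrDl lerD//.
    by rewrite (le_trans hW)// ler_wpM2r ?addr_ge0// /n ge_min lexx.
  by rewrite normcM ler_wpM2l ?normc_ge0//; exact: (normc_le (u +i* v)).
have Wr : normc W < r2.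
  apply: le_lt_trans W1 _; rewrite -ltr_pdivlMl// mulrC.
  rewrite [ltRHS](_ : _ = r2 / (2 * (1 + normc m)) + r2 / (2 * (1 + normc m))).
    exact: ltrD.
  by field; rewrite gt_eqF.
have {}hr2 := hr2 W Wr.
have -> : G (k (x + u) (y + v)) - G (k x y) - l * m * (u +i* v) =
   (G (k x y + W) - G (k x y) - l * W) + l * (W - m * (u +i* v)).
  have -> : k (x + u) (y + v) = k x y + W by rewrite /W subrKC.
  by move: (G _) (G _) => p q; ring.
apply: le_trans (normcD _ _) _; rewrite [e]splitr mulrDl lerD//.
  apply: le_trans hr2 _.
  apply: le_trans (ler_wpM2l (ltW e'0) W1) _; rewrite mulrA ler_wpM2r ?addr_ge0//.
  by rewrite le_eqVlt; apply/orP; left; apply/eqP; field; rewrite gt_eqF.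
rewrite normcM; apply: le_trans (ler_wpM2l (normc_ge0 _) hW) _; rewrite mulrA ler_wpM2r ?addr_ge0//.
have nle : n <= e / (2 * (1 + normc l)) by rewrite /n ge_min lexx orbT.
apply: le_trans (ler_wpM2l (normc_ge0 _) nle) _.
have X0 : 0 < e / (2 * (1 + normc l)) by rewrite divr_gt0// mulr_gt0.
have : e / (2 * (1 + normc l)) * (2 * (1 + normc l)) = e.
  by rewrite divfK// gt_eqF// mulr_gt0.
by move: X0; move: (e / _) => X; lra.
Qed.

(** The exponential at [t + i th], in the two-variable form to which [cdiff2] applies. It maps
    vertical segments of length [2 pi] to full circles, hence rectangles of that height to
    annuli. *)
Definition cexp (t th : R) : R[i] := (expR t)%:C * (cos th +i* sin th).

Lemma cexpD t th u v : cexp (t + u) (th + v) = cexp t th * cexp u v.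
Proof.
rewrite /cexp expRD cosD sinD rmorphM /=.
rewrite (_ : _ +i* _ = (cos th +i* sin th) * (cos v +i* sin v)); first by ring.
by apply/eqP; rewrite eq_complex /= eqxx addrC (mulrC (cos th)) eqxx.
Qed.

Lemma real_is_derive (f : R -> R) (x l e : R) : is_derive x 1 f l -> 0 < e ->
  exists2 r : R, 0 < r & forall u, `|u| < r -> `|f (x + u) - f x - l * u| <= e * `|u|.
Proof.
move=> [] /derivable1_diffP df fl e0.
have /nbhs_ballP[r /= r0 rP] := differentiable_near df e0.
exists r => // u ur; have := rP u; rewrite -ball_normE /= sub0r normrN => /(_ ur).
move=> H; apply: le_trans H.
rewrite le_eqVlt; apply/orP; left; apply/eqP; congr (`|_ - _|).
by rewrite -[u in RHS]mulr1 [RHS](_ : _ = 'd f x (u *: 1))// linearZ /= mulrC -fl deriveE.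
Qed.

(** The real derivatives of [expR], [cos] and [sin] at 0 give the complex derivative 1. *)
Lemma cexp_cdiff2_0 : cdiff2 cexp 0 0.
Proof.
exists 1 => e e0.
pose n := Num.min 1 (e / 8); have n0 : 0 < n by rewrite lt_min ltr01 divr_gt0.
have n1 : n <= 1 by rewrite /n ge_min lexx.
have ne : n <= e / 8 by rewrite /n ge_min lexx orbT.
have [r1 r10 h1] := real_is_derive (is_derive_expR 0) n0.
have [r2 r20 h2] := real_is_derive (is_derive_cos 0) n0.
have [r3 r30 h3] := real_is_derive (is_derive_sin 0) n0.
(* The bound [1 / 2] on [u] gives [expR u <= 2], and [e / 16] makes the cross term
   [(expR u - 1) * v] at most [e / 8 * |v|]. *)
exists (Num.min (Num.min r1 r2) (Num.min r3 (Num.min (1 / 2) (e / 16)))).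
  by rewrite !lt_min r10 r20 r30 /= !divr_gt0.
move=> u v; rewrite !lt_min => /and3P[/andP[u1 _] _ /andP[u4 u5]] /and3P[/andP[_ v2] v3 _].
have {h1} := h1 u u1; have {h2} := h2 v v2; have {h3} := h3 v v3.
rewrite !add0r sin0 cos0 expR0 /cexp expR0 cos0 sin0 !mul1r oppr0 mul0r !(addr0, subr0).
move=> hs hc he.
rewrite (_ : _ - _ - _ = (expR u * cos v - 1 - u) +i* (expR u * sin v - v)); last first.
  by apply/eqP; rewrite eq_complex /=; apply/andP; split; apply/eqP => /=; ring.
apply: le_trans (normc_le _) _ => /=.
have Eu : expR u <= 2.
  rewrite -[expR u](subrK (1 + u)); move: he; rewrite ler_norml => /andP[_].
  have := ler_norm u; have := normr_ge0 u; nra.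
have E0 := expR_gt0 u.
have -> : expR u * cos v - 1 - u = (expR u - 1 - u) + expR u * (cos v - 1) by ring.
have -> : expR u * sin v - v = expR u * (sin v - v) + ((expR u - 1 - u) + u) * v.
  by ring.
have he1 : `|expR u - 1 - u| <= `|u| by rewrite (le_trans he)// ler_piMl.
have {}he : `|expR u - 1 - u| <= e / 8 * `|u|.
  by rewrite (le_trans he)// ler_wpM2r.
have {}hc : `|expR u * (cos v - 1)| <= e / 4 * `|v|.
  rewrite normrM (gtr0_norm E0).
  apply: le_trans (ler_wpM2r (normr_ge0 _) Eu) _.
  by have := ler_wpM2r (normr_ge0 v) ne; lra.
have {}hs : `|expR u * (sin v - v)| <= e / 4 * `|v|.
  rewrite normrM (gtr0_norm E0).
  apply: le_trans (ler_wpM2r (normr_ge0 _) Eu) _.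
  by have := ler_wpM2r (normr_ge0 v) ne; lra.
have huv : `|((expR u - 1 - u) + u) * v| <= e / 8 * `|v|.
  rewrite normrM ler_wpM2r// (le_trans (ler_normD _ _))//.
  by move: u5; have := normr_ge0 u; lra.
apply: le_trans (lerD (ler_normD _ _) (ler_normD _ _)) _.
have := normr_ge0 u; have := normr_ge0 v; nra.
Qed.

End OneVariable.

(** * Means over circles *)

Section Circle.
Context {R : realType}.
Local Notation C := (R[i]^o).
Implicit Types (G : C -> C) (z w l : C).

(** The functional equation [cexpD] moves differentiability from the origin to every point. *)
Lemma cexp_cdiff2 (t th : R) : cdiff2 cexp t th.
Proof.
have [m hm] := @cexp_cdiff2_0 R; exists (cexp t th * m) => e e0.
have k0 : 0 < 1 + normc (cexp t th) by rewrite ltr_pwDl// normc_ge0.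
have [r r0 hr] := hm (e / (1 + normc (cexp t th))) ltac:(by rewrite divr_gt0).
exists r => // u v ur vr; have := hr u v ur vr; rewrite !add0r.
have -> : cexp 0 0 = 1 :> R[i].
  by rewrite /cexp expR0 cos0 sin0 mul1r.
move=> H; rewrite cexpD -mulrA -[X in _ - X - _]mulr1 -!mulrBr normcM.
apply: le_trans (ler_wpM2l (normc_ge0 _) H) _; rewrite mulrA ler_wpM2r ?addr_ge0//.
have X0 : 0 < e / (1 + normc (cexp t th)) by rewrite divr_gt0.
have : e / (1 + normc (cexp t th)) * (1 + normc (cexp t th)) = e by rewrite divfK// gt_eqF.
by move: X0; move: (e / _) => X; lra.
Qed.

Definition circ (r th : R) : C := r%:C * (cos th +i* sin th).

Lemma circE r th : 0 < r -> circ r th = cexp (ln r) th.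
Proof. by move=> r0; rewrite /cexp lnK. Qed.

Lemma normc_circ r th : 0 <= r -> normc (circ r th) = r.
Proof.
move=> r0; rewrite normcM normc_real ger0_norm//.
by rewrite /normc cos2Dsin2 sqrtr1 mulr1.
Qed.

Lemma circ_neq0 r th : 0 < r -> circ r th != 0.
Proof. by move=> r0; rewrite -normc_gt0 normc_circ// ltW. Qed.

Definition cmean (g : R -> R[i]) : R[i] := ((pi *+ 2)^-1)%:C * cint 0 (pi *+ 2) g.

Let tpi0 : 0 <= pi *+ 2 :> R.
Proof. by rewrite mulrn_wge0// pi_ge0. Qed.

Let tpi_neq0 : pi *+ 2 != 0 :> R.
Proof. by rewrite mulrn_eq0/= gt_eqF// pi_gt0. Qed.

Lemma cmean_cst k : cmean (fun=> k) = k.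
Proof. by rewrite /cmean cint_cst// subr0 mulrA -rmorphM mulVf// mul1r. Qed.

Lemma cmeanD g h : (forall x, ccont g x) -> (forall x, ccont h x) ->
  cmean (fun x => g x + h x) = cmean g + cmean h.
Proof. by move=> cg ch; rewrite /cmean cintD ?mulrDr// => x _. Qed.

Lemma cmeanB g h : (forall x, ccont g x) -> (forall x, ccont h x) ->
  cmean (fun x => g x - h x) = cmean g - cmean h.
Proof. by move=> cg ch; rewrite /cmean cintB ?mulrBr// => x _. Qed.

Lemma cmeanZ k g : (forall x, ccont g x) -> cmean (fun x => k * g x) = k * cmean g.
Proof. by move=> cg; rewrite /cmean cintZ 1?mulrCA// => x _. Qed.

(** The factor 2 is inherited from [normc_cint_le]. *)
Lemma normc_cmean_le g (k : R) : (forall x, ccont g x) ->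
  (forall x, normc (g x) <= k) -> normc (cmean g) <= 2 * k.
Proof.
move=> cg gk; rewrite /cmean normcM normc_real ger0_norm ?invr_ge0//.
have := @normc_cint_le R 0 (pi *+ 2) g k tpi0 (fun x _ => cg x) (fun x _ => gk x).
rewrite subr0 => /(ler_wpM2l (_ : 0 <= (pi *+ 2)^-1)); rewrite invr_ge0 => /(_ tpi0).
by rewrite mulrCA mulVf// mulr1.
Qed.

Lemma ccont_circ G r th : 0 < r -> derivable G (circ r th) 1 ->
  ccont (fun x => G (circ r x)) th.
Proof.
move=> r0; rewrite circE// => /derivable_cdiff dG.
have := cdiff2_cconty (cdiff2_comp (cexp_cdiff2 _ _) dG).
by under [X in _ -> ccont X _]eq_fun do rewrite circE//.
Qed.

(** Goursat's theorem for [G] composed with [cexp], on the rectangle from [ln r1] to [ln r2] of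
    height [2 pi]: the horizontal sides cancel by periodicity, and the vertical ones are the two
    circle integrals. *)
Lemma cmean_circ_const G r1 r2 : 0 < r1 -> r1 <= r2 ->
  (forall w, r1 <= normc w <= r2 -> derivable G w 1) ->
  cmean (fun x => G (circ r1 x)) = cmean (fun x => G (circ r2 x)).
Proof.
move=> r10 r12 dG; have r20 := lt_le_trans r10 r12.
have l12 : ln r1 <= ln r2 by rewrite ler_ln// posrE.
have H : cdiff2_on (fun x y => G (cexp x y)) (ln r1) (ln r2) 0 (pi *+ 2).
  move=> x y /andP[x1 x2] _; apply: cdiff2_comp (cexp_cdiff2 _ _) _.
  apply: derivable_cdiff; apply: dG.
  have -> : cexp x y = circ (expR x) y by [].
  rewrite normc_circ ?expR_ge0//.
  rewrite -(@lnK _ r1) ?posrE// -(@lnK _ r2) ?posrE//.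
  by rewrite !ler_expR x1.
have := goursat l12 tpi0 H; rewrite /rect_int.
rewrite (_ : (fun x => G (cexp x 0) - G (cexp x (pi *+ 2))) = (fun=> 0)); last first.
  by apply/funext => x; rewrite /cexp cos0 sin0 cos2pi sin2pi subrr.
rewrite cint_cst// mulr0 add0r cintB; last first.
  - move=> y y2; apply: (cdiff2_cconty (H _ _ _ y2)).
    by rewrite lexx.
  - move=> y y2; apply: (cdiff2_cconty (H _ _ _ y2)).
    by rewrite lexx l12.
move=> /eqP; rewrite mulf_eq0 -normc_eq0 normc_i oner_eq0/= subr_eq0 => /eqP E.
rewrite /cmean; congr (_ * _).
have cE r : 0 < r -> (fun x => G (circ r x)) = (fun y => G (cexp (ln r) y)).
  by move=> r0; apply/funext => x; rewrite circE.
rewrite (cE _ r10) (cE _ r20); exact: (esym E).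
Qed.

(* The value of [G] at the centre is irrelevant: only its limit [g0] there matters. *)
Lemma cmean_circ G g0 r : 0 < r ->
  (forall e : R, 0 < e -> exists2 s : R, 0 < s &
    forall w, w != 0 -> normc w < s -> normc (G w - g0) <= e) ->
  (forall w, 0 < normc w <= r -> derivable G w 1) ->
  cmean (fun x => G (circ r x)) = g0.
Proof.
move=> r0 Gg dG; apply/eqP; rewrite -subr_eq0; apply/eqP/normc_small_eq0 => e e0.
(* The mean will be moved to a circle of radius [t < s]; the half compensates the factor 2 of
   [normc_cmean_le]. *)
have [s s0 hs] := Gg (e / 2) ltac:(by rewrite divr_gt0).
pose t := Num.min r (s / 2).
have t0 : 0 < t by rewrite lt_min r0 divr_gt0.
have tr : t <= r by rewrite /t ge_min lexx.
have ts : t < s by rewrite gt_min ltr_pdivrMr// ltr_pMr// ltr1n orbT.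
rewrite -(@cmean_circ_const G t r)//; last first.
  by move=> w /andP[tw wr]; apply: dG; rewrite wr (lt_le_trans t0).
have cG y : ccont (fun x => G (circ t x)) y.
  by apply: ccont_circ => //; apply: dG; rewrite normc_circ ?t0// ltW.
rewrite -[g0]cmean_cst -cmeanB//; last by move=> x; exact: ccont_cst.
have -> : e = 2 * (e / 2) by field.
apply: normc_cmean_le => x; first by apply: ccontB => //; exact: ccont_cst.
by apply: hs; [exact: circ_neq0|rewrite normc_circ// ltW].
Qed.

End Circle.

(** * Cauchy estimates and the first order Taylor remainder *)

Section Cauchy.
Context {R : realType}.
Local Notation C := (R[i]^o).
Implicit Types (f : C -> C) (z w p : C).

Let addrBK' (p c : C) : p + c - p = c.
Proof. by rewrite addrAC subrr add0r. Qed.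

Let subrACA' (a b c d : C) : a - b - (c - d) = a - c - (b - d).
Proof. by ring. Qed.

Lemma derivable_shift f p w : derivable f (p + w) 1 ->
  derivable (fun x => f (p + x)) w 1.
Proof.
move=> /derivable1_diffP df; apply/derivable1_diffP.
have dp : differentiable (fun x : C => p + x) w.
  apply: (@differentiableD _ _ _ (cst p) id); first exact: differentiable_cst.
  by case: (is_diff_id w).
exact: (@differentiable_comp _ _ _ _ (fun x : C => p + x) f w dp df).
Qed.

Lemma mean_value f p (r : R) : 0 < r ->
  (forall w, normc (w - p) <= r -> derivable f w 1) ->
  cmean (fun x => f (p + circ r x)) = f p.
Proof.
move=> r0 df.
apply: (@cmean_circ _ (fun w => f (p + w)) _ r r0).
  have : derivable f p 1 by apply: df; rewrite subrr normc0 ltW.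
  move=> /derivable_cdiff dp e e0; have [s s0 hs] := cdiff_cont dp e0.
  by exists s => // w _; exact: hs.
move=> w /andP[_ wr]; apply: derivable_shift; apply: df.
by rewrite addrBK'.
Qed.

(** The difference quotient is holomorphic off the centre and tends to the derivative there, so
    [cmean_circ] applies to it. This is Cauchy's formula for the derivative. *)
Lemma mean_value_derive f p (r : R) : 0 < r ->
  (forall w, normc (w - p) <= r -> derivable f w 1) ->
  cmean (fun x => (circ r x)^-1 * (f (p + circ r x) - f p)) = 'D_1 f p.
Proof.
move=> r0 df.
apply: (@cmean_circ _ (fun w => w^-1 * (f (p + w) - f p)) _ r r0).
  have : derivable f p 1 by apply: df; rewrite subrr normc0 ltW.
  move=> /derivable_cdiff dp e e0; have [s s0 hs] := dp _ e0.
  exists s => // w w0 ws.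
  have -> : w^-1 * (f (p + w) - f p) - 'D_1 f p = w^-1 * (f (p + w) - f p - 'D_1 f p * w).
    by rewrite [RHS]mulrBr (mulrC ('D_1 f p)) mulKf.
  rewrite normcM normcV ler_pdivrMl ?normc_gt0//.
  by rewrite [leRHS]mulrC; exact: hs.
move=> w /andP[w0 wr]; apply: derivableM.
  by apply: derivableV => //; rewrite -normc_gt0.
apply: derivableB; last exact: derivable_cst.
apply: derivable_shift; apply: df.
by rewrite addrBK'.
Qed.

Let ccont_quot f p (r : R) y : 0 < r ->
  (forall w, normc (w - p) <= r -> derivable f w 1) ->
  ccont (fun x => (circ r x)^-1 * (f (p + circ r x) - f p)) y.
Proof.
move=> r0 df; apply: (@ccont_circ _ (fun w => w^-1 * (f (p + w) - f p))) => //.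
apply: derivableM.
  by apply: derivableV => //; exact: circ_neq0.
apply: derivableB; last exact: derivable_cst.
apply: derivable_shift; apply: df.
by rewrite addrBK' normc_circ// ltW.
Qed.

(** The quotient of [mean_value_derive] is at most [2 * M / r] on the circle, and [normc_cmean_le]
    doubles this. *)
Lemma derive_bound f p (r M : R) : 0 < r ->
  (forall w, normc (w - p) <= r -> derivable f w 1 /\ normc (f w) <= M) ->
  normc ('D_1 f p) <= 4 * M / r.
Proof.
move=> r0 H; have df w : normc (w - p) <= r -> derivable f w 1 by case/H.
rewrite -(mean_value_derive r0 df).
have -> : 4 * M / r = 2 * (r^-1 * (M + M)) by field; rewrite gt_eqF.
apply: normc_cmean_le => x; first exact: ccont_quot.
rewrite normcM normcV normc_circ ?(ltW r0)// ler_wpM2l ?invr_ge0 ?(ltW r0)//.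
apply: le_trans (normcB _ _) _; rewrite lerD//.
  have [|//] := H (p + circ r x); by rewrite addrBK' normc_circ// ltW.
have [|//] := H p; by rewrite subrr normc0 ltW.
Qed.

Lemma real_is_deriveP (g : R -> R) (x l : R) :
  (forall e : R, 0 < e -> exists2 r : R, 0 < r & forall u, `|u| < r ->
     `|g (x + u) - g x - l * u| <= e * `|u|) -> is_derive x 1 g l.
Proof.
move=> H.
suff cl : (fun h => h^-1 *: ((g \o shift x) (h *: 1) - g x)) @ 0^' --> l.
  by apply: DeriveDef; [apply/cvg_ex; exists l|exact: cvg_lim cl].
apply/cvgrPdist_le => e e0; have [r r0 hr] := H e e0.
near=> h; have h0 : h != 0 by near: h; exact: nbhs_dnbhs_neq.
have := hr h; rewrite (_ : `|h| < r); last first.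
  by near: h; apply: dnbhs0_lt.
move=> /(_ isT); rewrite -ler_pdivrMr ?normr_gt0// => H1; apply: le_trans H1.
rewrite -normfV -normrM -normrN /= /GRing.scale /= mulr1 (addrC x).
rewrite le_eqVlt; apply/orP; left; apply/eqP; congr (`|_|).
by field.
Unshelve. all: by end_near. Qed.

(** The mean value theorem concerns real-valued functions, so it is applied separately to the real
    and imaginary parts along the segment; adding the two bounds gives the factor 2. *)
Lemma lipschitz f p v (K : R) :
  (forall s : R, 0 <= s <= 1 -> derivable f (p + s%:C * v) 1 /\
     normc ('D_1 f (p + s%:C * v)) <= K) ->
  normc (f (p + v) - f p) <= 2 * K * normc v.
Proof.
move=> H.
pose g s := f (p + s%:C * v).
have dg (s e : R) : 0 <= s <= 1 -> 0 < e -> exists2 r : R, 0 < r & forall u, `|u| < r ->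
    normc (g (s + u) - g s - 'D_1 f (p + s%:C * v) * (u%:C * v)) <= e * `|u|.
  move=> s01 e0; have [/derivable_cdiff ds _] := H s s01.
  have k0 : 0 < 1 + normc v by rewrite ltr_pwDl// normc_ge0.
  have [r r0 hr] := ds (e / (1 + normc v)) ltac:(by rewrite divr_gt0).
  exists (r / (1 + normc v)); first by rewrite divr_gt0.
  move=> u; rewrite ltr_pdivlMr// => ur.
  have uv : normc (u%:C * v) <= `|u| * (1 + normc v).
    by rewrite normcM normc_real ler_wpM2l// lerDr.
  have := hr (u%:C * v) (le_lt_trans uv ur).
  rewrite /g rmorphD mulrDl addrA => /le_trans; apply.
  have ek : 0 <= e / (1 + normc v) by rewrite ltW// divr_gt0.
  apply: le_trans (ler_wpM2l ek uv) _.
  by rewrite mulrCA divfK ?gt_eqF// mulrC.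
(* Here [h] stands for either the real or the imaginary part. *)
have bnd (h : R[i] -> R) : (forall a b, h (a - b) = h a - h b) ->
    (forall w, `|h w| <= normc w) -> (forall (x : R) w, h (x%:C * w) = x * h w) ->
    `|h (g 1) - h (g 0)| <= K * normc v.
  move=> hB hle hZ.
  have dh (s : R) : 0 <= s <= 1 -> is_derive s 1 (h \o g) (h ('D_1 f (p + s%:C * v) * v)).
    move=> s01; apply: real_is_deriveP => e e0; have [r r0 hr] := dg s e s01 e0.
    exists r => // u ur; apply: le_trans (hr u ur); apply: le_trans (hle _).
    by rewrite !hB (mulrCA _ u%:C) hZ (mulrC u).
  have [|x||x x01] := @MVT_segment R (h \o g) (fun s => h ('D_1 f (p + s%:C * v) * v)) 0 1.
  - exact: ler01.
  - by rewrite in_itv /= => /andP[x0 x1]; apply: dh; rewrite !ltW.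
  - apply: derivable_within_continuous => x; rewrite in_itv /= => x01.
    by have := dh x x01 => -[].
  rewrite /= subr0 mulr1 => ->; rewrite in_itv /= in x01.
  apply: le_trans (hle _) _; rewrite normcM ler_wpM2r ?normc_ge0//.
  by have [] := H x x01.
have -> : f (p + v) - f p = g 1 - g 0 by rewrite /g mul1r mul0r addr0.
have -> : 2 * K * normc v = K * normc v + K * normc v by ring.
apply: le_trans (normc_le _) _; rewrite !raddfB /= lerD//.
  by apply: (bnd (@complex.Re R)) => [[? ?] [? ?]|w|x [a b]]; rewrite ?normc_Re//= mul0r subr0.
by apply: (bnd (@complex.Im R)) => [[? ?] [? ?]|w|x [a b]]; rewrite ?normc_Im//= mul0r addr0.
Qed.

(** The derivative of [f w - 'D_1 f 0 * w] is ['D_1 f w - 'D_1 f 0], which is bounded linearly in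
    [normc w]; [lipschitz] then yields a quadratic bound. *)
Lemma taylor1_bound f z (r M : R) : 0 < r -> normc z <= r ->
  (forall w, normc w <= 3 * r -> derivable f w 1 /\ normc (f w) <= M) ->
  normc (f z - f 0 - 'D_1 f 0 * z) <= 64 * M * (normc z / r) ^+ 2.
Proof.
move=> r0 zr H.
(* The radius [3 * r] leaves room for discs of radius [r] about points of modulus at most
   [2 * r]. *)
have dH p w : normc p <= 2 * r -> normc (w - p) <= r -> derivable f w 1 /\ normc (f w) <= M.
  move=> pr wp; apply: H; rewrite -[w](subrK p) (le_trans (normcD _ _))//; lra.
have dB p : normc p <= 2 * r -> normc ('D_1 f p) <= 4 * M / r.
  by move=> pr; apply: derive_bound => // w; exact: dH.
have seg p v s : normc p <= 2 * r -> normc (p + v) <= 2 * r -> 0 <= s <= 1 ->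
   normc (p + s%:C * v) <= 2 * r.
  move=> pr pvr /andP[s0 s1].
  have -> : p + s%:C * v = (1 - s)%:C * p + s%:C * (p + v) by rewrite rmorphB rmorph1; ring.
  apply: le_trans (normcD _ _) _; rewrite !normcM !normc_real ger0_norm ?subr_ge0//.
  rewrite ger0_norm//; nra.
have M0 : 0 <= M.
  have [|_ fM] := H 0; first by rewrite normc0; lra.
  exact: le_trans (normc_ge0 _) fM.
have L p v : normc p <= 2 * r -> normc (p + v) <= 2 * r ->
    normc (f (p + v) - f p) <= 8 * M / r * normc v.
  move=> pr pvr; rewrite (_ : 8 * M / r = 2 * (4 * M / r)); last by ring.
  apply: lipschitz => s s01; have sr := seg p v s pr pvr s01; split; last exact: dB.
  by have [|//] := dH _ (p + s%:C * v) sr; rewrite subrr normc0 ltW.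
(* Both derivatives are means of difference quotients over circles of the same radius [r], so their
   difference is a mean that [L] can bound. *)
have DL p : normc p <= r -> normc ('D_1 f p - 'D_1 f 0) <= 32 * M / r ^+ 2 * normc p.
  move=> pr.
  have dp w : normc (w - p) <= r -> derivable f w 1.
    by move=> wp; have [||//] := dH p w => //; lra.
  have d0 w : normc (w - 0) <= r -> derivable f w 1.
    by move=> wp; have [||//] := dH 0 w => //; rewrite normc0; lra.
  rewrite -(mean_value_derive r0 dp) -(mean_value_derive r0 d0) -cmeanB; first last.
  - by move=> x; exact: ccont_quot.
  - by move=> x; exact: ccont_quot.
  have -> : 32 * M / r ^+ 2 * normc p = 2 * (r^-1 * (8 * M / r * normc p + 8 * M / r * normc p)).
    by field; rewrite gt_eqF.
  apply: normc_cmean_le => x; first by apply: ccontB; exact: ccont_quot.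
  rewrite -mulrBr normcM normcV normc_circ ?(ltW r0)// ler_wpM2l ?invr_ge0 ?(ltW r0)//.
  have cr : normc (circ r x) = r by rewrite normc_circ// ltW.
  (* Regrouped, both differences are increments of [f] under translation by [p]. *)
  have -> : f (p + circ r x) - f p - (f (0 + circ r x) - f 0) =
      (f (circ r x + p) - f (circ r x)) - (f (0 + p) - f 0).
    by rewrite !add0r (addrC p); exact: subrACA'.
  apply: le_trans (normcB _ _) _; rewrite lerD//; apply: L; rewrite ?normc0; try lra.
    by apply: le_trans (normcD _ _) _; lra.
  by rewrite add0r; lra.
have D0 : derivable f 0 1 by have [|//] := H 0; rewrite normc0; lra.
pose g w := f w - 'D_1 f 0 * w.
have dg w : normc w <= r -> is_derive (w : C) 1 (g : C -> C) ('D_1 f w - 'D_1 f 0).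
  move=> wr; have dfw : derivable f w 1 by have [|//] := H w; lra.
  have df := derivableP dfw.
  have dl : is_derive w 1 (fun x : C => 'D_1 f 0 *: x) ('D_1 f 0 *: 1).
    by apply: is_deriveZ; exact: is_derive_id.
  by apply: is_derive_eq (is_deriveB df dl) _; rewrite /GRing.scale /= mulr1.
have -> : f z - f 0 - 'D_1 f 0 * z = g (0 + z) - g 0 by rewrite /g add0r mulr0; ring.
have -> : 64 * M * (normc z / r) ^+ 2 = 2 * (32 * M / r ^+ 2 * normc z) * normc z.
  by field; rewrite gt_eqF.
apply: lipschitz => s /andP[s0 s1]; rewrite add0r.
have szr : normc (s%:C * z) <= normc z.
  by rewrite normcM normc_real ger0_norm// ler_piMl ?normc_ge0.
have [dgs ->] := dg (s%:C * z) (le_trans szr zr); split => //.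
apply: le_trans (DL _ (le_trans szr zr)) _; rewrite ler_wpM2l//.
by rewrite divr_ge0 ?mulr_ge0 ?exprn_ge0// ltW.
Qed.

End Cauchy.

(** * Hartogs extension *)

Section NormedModule.
Context {R : realType} {V : normedModType R[i]}.
Local Notation C := (R[i]^o).
Implicit Types (f : V -> C) (p v x : V).

(** The norm of a module over [R[i]] is an element of [R[i]]; being real, it is recovered from its
    real part ([rnormE]). *)
Definition rnorm v : R := complex.Re `|v|.

Lemma rnormE v : `|v| = (rnorm v)%:C.
Proof. by apply/esym/RRe_real; apply: ger0_real; exact: normr_ge0. Qed.

Lemma rnorm_ge0 v : 0 <= rnorm v.
Proof. by rewrite -ler0c -rnormE normr_ge0. Qed.

Lemma rnorm0 : rnorm 0 = 0.
Proof. by rewrite /rnorm normr0. Qed.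

Lemma rnorm_gt0 v : (0 < rnorm v) = (v != 0).
Proof. by rewrite -ltcR -rnormE normr_gt0. Qed.

Lemma rnormD v x : rnorm (v + x) <= rnorm v + rnorm x.
Proof. by have := ler_normD v x; rewrite !rnormE -rmorphD lecR. Qed.

Lemma rnormZ (k : R[i]) v : rnorm (k *: v) = normc k * rnorm v.
Proof. by have := normrZ k v; rewrite !rnormE normcE -rmorphM => /complexI. Qed.

Lemma line_derivable f p v (w : C) : differentiable f (p + w *: v) ->
  derivable (fun l : C => f (p + l *: v)) w 1 /\
  'D_1 (fun l : C => f (p + l *: v)) w = 'd f (p + w *: v) v.
Proof.
move=> df.
have dl : is_diff (w : C) (fun l : C => p + l *: v) (fun l : C => l *: v).
  have := is_diffD (is_diff_cst p (w : C)) (is_diff_scalel (w : C) v).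
  by rewrite add0r.
have dlw : differentiable (fun l : C => p + l *: v) (w : C) by case: dl.
have dc : differentiable (fun l : C => f (p + l *: v)) w.
  exact: (@differentiable_comp _ _ _ _ (fun l : C => p + l *: v) f).
split; first exact/derivable1_diffP.
rewrite deriveE// (@diff_comp _ _ _ _ (fun l : C => p + l *: v) f)//=.
by case: dl => _ ->; rewrite scale1r.
Qed.

(** This is [taylor1_bound] at the point 1 on the complex line through [p] with direction [v], with
    [r = d / (3 * rnorm v)]. Parameters of modulus [3 * r] correspond to displacements of norm [d],
    and [576 = 64 * 3 ^ 2]. *)
Lemma taylor1_bound_normed f p v (d M : R) : 0 < d -> rnorm v <= d / 3 ->
  (forall x, rnorm x <= d -> differentiable f (p + x) /\ normc (f (p + x)) <= M) ->
  normc (f (p + v) - f p - 'd f p v) <= 576 * M * (rnorm v / d) ^+ 2.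
Proof.
move=> d0 vd H.
have [->|v0] := eqVneq v 0.
  by rewrite addr0 subrr sub0r normcN linear0 normc0 rnorm0 mul0r expr0n mulr0.
have nv : 0 < rnorm v by rewrite rnorm_gt0.
pose r := d / (3 * rnorm v); have r0 : 0 < r by rewrite divr_gt0// mulr_gt0.
have := @taylor1_bound R (fun l => f (p + l *: v)) 1 r M r0.
rewrite normc1 scale1r scale0r addr0 ler_pdivlMr ?mulr_gt0// mul1r => T.
have [_ D0] := @line_derivable f p v 0 ltac:(rewrite scale0r; have [|//] := H 0; by rewrite rnorm0 ltW).
rewrite D0 scale0r addr0 mulr1 in T.
have -> : 576 * M * (rnorm v / d) ^+ 2 = 64 * M * (1 / r) ^+ 2.
  by rewrite /r; field; rewrite !gt_eqF.
apply: T; first lra.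
move=> w wr; have wd : rnorm (w *: v) <= d.
  rewrite rnormZ (le_trans (ler_wpM2r (ltW nv) wr))// /r.
  by rewrite le_eqVlt; apply/orP; left; apply/eqP; field; rewrite gt_eqF.
have [dw fw] := H _ wd; split=> //.
by have [] := line_derivable dw.
Qed.

(** The quadratic remainder gives the little-o expansion. Continuity of [L] is deduced from the two
    bounds: [L v] is the difference of an increment of [f] and a remainder, both bounded near 0. *)
Lemma differentiable_quad f p (L : {linear V -> C}) (d K : R) : 0 < d ->
  (forall v, rnorm v < d -> normc (f (p + v)) <= K) ->
  (forall v, rnorm v < d -> normc (f (p + v) - f p - L v) <= K * rnorm v ^+ 2) ->
  differentiable f p.
Proof.
move=> d0 fK H.
have K0 : 0 <= K by have := fK 0; rewrite rnorm0 => /(_ d0); apply: le_trans; exact: normc_ge0.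
have nd (r : R) : 0 < r -> \forall v \near (0 : V), rnorm v < r.
  move=> r0; have r0' : 0 < r%:C by rewrite ltcR.
  near=> v; rewrite -ltcR -rnormE; near: v; exact: (nbhs0_lt r0').
have Lc : continuous L.
  apply: bounded_linear_continuous.
  exists (K * d ^+ 2 + K + K)%:C; split; first by apply/complex_realP; exists (K * d ^+ 2 + K + K).
  move=> M MK; near=> v; apply: le_trans (ltW MK).
  have vd : rnorm v < d by near: v; exact: nd.
  rewrite normcE lecR.
  have -> : L v = (f (p + v) - f p) - (f (p + v) - f p - L v) by rewrite opprB addrCA subrr addr0.
  have h1 : normc (f (p + v) - f p) <= K + K.
    apply: le_trans (normcB _ _) _; rewrite lerD// ?fK//.
    by have := fK 0; rewrite addr0 rnorm0; exact.
  have h2 : normc (f (p + v) - f p - L v) <= K * d ^+ 2.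
    apply: le_trans (H v vd) _; rewrite ler_wpM2l// ler_pXn2r ?nnegrE ?rnorm_ge0//; exact: ltW.
  by apply: le_trans (normcB _ _) _; lra.
have E : f \o shift p = (cst (f p) + L) +o_ (0 : V) id.
  apply/eqaddoP => e e0.
  have eE : (complex.Re e)%:C = e by apply: RRe_real; apply: gtr0_real.
  have e0' : 0 < complex.Re e by rewrite -ltcR eE.
  have K1 : 0 < K + 1 by lra.
  near=> v; have vd : rnorm v < d by near: v; exact: nd.
  have ve : rnorm v < complex.Re e / (K + 1).
    by near: v; apply: nd; rewrite divr_gt0.
  rewrite normcE rnormE -eE -rmorphM lecR.
  rewrite [X in normc X](_ : _ = f (p + v) - f p - L v); last first.
    by rewrite /= !fctE /= opprD addrA (addrC v).
  apply: le_trans (H v vd) _; rewrite expr2 mulrA ler_wpM2r ?rnorm_ge0//.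
  have : rnorm v * (K + 1) < complex.Re e by rewrite -ltr_pdivlMr.
  have := rnorm_ge0 v; lra.
by apply/diff_locallyP; rewrite (diff_unique Lc E).
Unshelve. all: by end_near. Qed.

End NormedModule.

Section Coordinates.
Context {R : realType} {n : nat}.
Local Notation V := 'rV[R[i]]_n.

Lemma rnorm_coord (v : V) j : normc (v 0 j) <= rnorm v.
Proof.
rewrite leNgt; apply/negP => lt.
have : ball (0 : (V : normedModType R[i])) (normc (v 0 j))%:C (v : (V : normedModType R[i])).
  by rewrite -ball_normE /= sub0r normrN rnormE ltcR.
move=> [_ /(_ 0 j)]; rewrite mxE -ball_normE /= sub0r normrN normcE.
by rewrite ltcR ltxx.
Qed.

Lemma rnorm_delta (j : 'I_n) : rnorm (delta_mx 0 j : V) <= 1.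
Proof.
rewrite -lecR -rnormE -[leLHS]/(mx_norm _).
have [->|/mx_norm_neq0[i ->]] := eqVneq (mx_norm (delta_mx 0 j : V)) 0; first exact: ler01.
by rewrite mxE; case: andP => _; rewrite ?normr1 ?normr0 ?ler01.
Qed.

End Coordinates.

(** * Uniform bounds around a circle *)

Section CircleBound.
Context {R : realType} {V : normedModType R[i]}.
Local Notation C := (R[i]^o).

Lemma circ_periodic (r th : R) :
  exists2 t, 0 <= t <= pi *+ 2 & circ r th = circ r t.
Proof.
have T0 : 0 < pi *+ 2 :> R by rewrite mulrn_wgt0// pi_gt0.
pose k := Num.floor (th / (pi *+ 2)).
have kle : k%:~R <= th / (pi *+ 2) by exact: Num.Theory.floor_le.
have klt : th / (pi *+ 2) < (k + 1)%:~R by exact: Num.Theory.floorD1_gt.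
exists (th - (pi *+ 2) *~ k).
  rewrite ler_pdivlMr// in kle; rewrite ltr_pdivrMr// in klt.
  rewrite -mulrzl; rewrite intrD mulrDl mul1r in klt.
  apply/andP; split; lra.
rewrite /circ; case: {kle klt} k => m.
  rewrite -[in LHS](subrK ((pi *+ 2) *~ Posz m) th) -pmulrn.
  by rewrite (periodicn (@cosD2pi R)) (periodicn (@sinD2pi R)).
rewrite NegzE mulrNz opprK -pmulrn.
by rewrite (periodicn (@cosD2pi R)) (periodicn (@sinD2pi R)).
Qed.

Lemma circ_ccont (r th : R) : 0 < r -> ccont (circ r) th.
Proof.
by move=> r0; apply: (@ccont_circ R id); [|exact: derivable_id].
Qed.

Lemma differentiable_near_le (f : V -> C) p (e : R) : differentiable f p -> 0 < e ->
  exists2 s : R, 0 < s & forall v, rnorm v < s -> normc (f (p + v) - f p) <= e.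
Proof.
move=> /differentiable_continuous /cvgrPdist_le fc e0.
have e0' : 0 < e%:C by rewrite ltcR.
have [s s0 hs] := nbhs_normc (fc _ e0').
exists s => // v vs; have := hs (p + v).
by rewrite addrAC subrr add0r rnormE ltcR normcE lecR normc_distC; exact.
Qed.

(** Continuity bounds [f] near each point of the circle, and compactness of the interval of angles
    makes this uniform. A single integer [N] serves both as the bound and, through [N.+1%:R^-1], as
    the radius. *)
Lemma circle_bound (f : V -> C) (y e : V) (r : R) : 0 < r ->
  (forall th, differentiable f (y + circ r th *: e)) ->
  exists d M : R, 0 < d /\ forall th v, rnorm v <= d ->
    normc (f (y + circ r th *: e + v)) <= M.
Proof.
move=> r0 df.
have /compact_near_coveringP := @segment_compact R 0 (pi *+ 2).
move=> /(_ nat \oo (fun N th => forall v, rnorm v <= N.+1%:R^-1 ->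
   normc (f (y + circ r th *: e + v)) <= N%:R)) [].
  move=> t _; have [s s0 hs] := differentiable_near_le (df t) ltr01.
  have s20 : 0 < s / 2 by rewrite divr_gt0.
  have k0 : 0 < rnorm e + 1 by rewrite ltr_wpDl ?rnorm_ge0.
  near=> t' N.
  have Ns : N.+1%:R^-1 < s / 2 by near: N; exact: (near_infty_natSinv_lt (PosNum s20)).
  have NM : 1 + normc (f (y + circ r t *: e)) <= N%:R by near: N; exact: nbhs_infty_ger.
  have tt : normc (circ r t' - circ r t) <= s / 2 / (rnorm e + 1).
    by near: t'; apply: circ_ccont => //; rewrite !divr_gt0.
  move=> v vN.
  have -> : y + circ r t' *: e + v = y + circ r t *: e + ((circ r t' - circ r t) *: e + v).
    by rewrite addrA -[y + _ + _ *: e]addrA -scalerDl subrKC.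
  rewrite -[f _](subrK (f (y + circ r t *: e))).
  apply: le_trans (normcD _ _) _.
  apply: (@le_trans _ _ (1 + normc (f (y + circ r t *: e)))).
    rewrite lerD2r; apply: hs; apply: le_lt_trans (rnormD _ _) _.
    rewrite [ltRHS]splitr; apply: ler_ltD.
      rewrite rnormZ; apply: (@le_trans _ _ (s / 2 / (rnorm e + 1) * (rnorm e + 1))).
        by apply: ler_pM; rewrite ?normc_ge0 ?rnorm_ge0 ?lerDl.
      by rewrite divfK// gt_eqF.
    exact: le_lt_trans vN _.
  exact: NM.
move=> N _ /(_ N (leqnn N)) H.
exists N.+1%:R^-1, N%:R; split; first by rewrite invr_gt0.
move=> th v vN; have [t t01 ->] := circ_periodic r th.
by apply: H => //=; rewrite in_itv.
Unshelve. all: by end_near. Qed.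

End CircleBound.

Lemma ccont_uniform_limit (R : realType) (g : R -> R[i]) (x : R) :
  (forall e : R, 0 < e -> exists2 h, ccont h x & forall y, normc (g y - h y) <= e) ->
  ccont g x.
Proof.
move=> H e e0; have [h hc gh] := H (e / 3) ltac:(by rewrite divr_gt0).
near=> y.
have -> : g y - g x = (g y - h y) + (h y - h x) - (g x - h x) by ring.
have hy : normc (h y - h x) <= e / 3 by near: y; apply: hc; rewrite divr_gt0.
apply: le_trans (normcB _ _) _; have := normcD (g y - h y) (h y - h x).
by have := gh y; have := gh x; lra.
Unshelve. all: by end_near. Qed.

(** * Differentiability of circular means *)

Section CircleMean.
Context {R : realType} {V : normedModType R[i]}.
Local Notation C := (R[i]^o).

Section At.
Variables (f : V -> C) (x e : V) (r d M : R).
Hypotheses (r0 : 0 < r) (d0 : 0 < d).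
Hypothesis H : forall th v, rnorm v <= d ->
  differentiable f (x + circ r th *: e + v) /\
  normc (f (x + circ r th *: e + v)) <= M.
Local Notation q th := (x + circ r th *: e).

Let M0 : 0 <= M.
Proof.
have [|_] := @H 0 0; first by rewrite rnorm0 ltW.
by apply: le_trans; exact: normc_ge0.
Qed.

Let taylor th v : rnorm v <= d / 3 ->
  normc (f (q th + v) - f (q th) - 'd f (q th) v) <= 576 * M * (rnorm v / d) ^+ 2.
Proof. by move=> vd; apply: taylor1_bound_normed => // w; exact: H. Qed.

Let ccont_f v th : rnorm v <= d -> ccont (fun t => f (q t + v)) th.
Proof.
move=> vd; pose g (w : C) := f (x + v + w *: e).
have -> : (fun t => f (q t + v)) = (fun t => g (circ r t)).
  by apply/funext => t; rewrite /g addrAC.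
apply: ccont_circ => //.
have [|//] := @line_derivable _ _ f (x + v) e (circ r th).
by rewrite addrAC; have [] := H th vd.
Qed.

Let ccont_f0 th : ccont (fun t => f (q t)) th.
Proof.
have := @ccont_f 0 th; rewrite rnorm0 => /(_ (ltW d0)).
by under [X in ccont X _ -> _]eq_fun do rewrite addr0.
Qed.

(** By the Taylor bound the differential along the circle is a uniform limit of difference
    quotients, which are continuous in the angle. It can therefore be averaged. *)
Let ccont_d v th : ccont (fun t => 'd f (q t) v) th.
Proof.
apply: ccont_uniform_limit => ep ep0.
pose K := 576 * M * (rnorm v / d) ^+ 2.
have K0 : 0 <= K by rewrite /K; have := M0; have := sqr_ge0 (rnorm v / d); nra.
(* The first bound makes the error [l * K] at most [ep]; the second keeps [l *: v] within radius
   [d / 3]. *)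
pose l := Num.min (ep / (K + 1)) (d / 3 / (rnorm v + 1)).
have K1 : 0 < K + 1 by lra.
have v1 : 0 < rnorm v + 1 by rewrite ltr_wpDl ?rnorm_ge0.
have l0 : 0 < l by rewrite lt_min !divr_gt0.
have lv : rnorm (l%:C *: v) = l * rnorm v by rewrite rnormZ normc_real gtr0_norm.
have lvd : rnorm (l%:C *: v) <= d / 3.
  rewrite lv; apply: (@le_trans _ _ (d / 3 / (rnorm v + 1) * (rnorm v + 1))); last by rewrite divfK// gt_eqF.
  by apply: ler_pM; rewrite ?rnorm_ge0 ?(ltW l0) ?lerDl// /l ge_min lexx orbT.
have lC : l%:C != 0 by rewrite -normc_eq0 normc_real normr_eq0 gt_eqF.
exists (fun t => (l%:C)^-1 * (f (q t + l%:C *: v) - f (q t))).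
  apply: ccontZ; apply: ccontB => //; apply: ccont_f; apply: le_trans lvd _; have := d0; lra.
move=> t.
have -> : 'd f (q t) v - (l%:C)^-1 * (f (q t + l%:C *: v) - f (q t)) =
    - ((l%:C)^-1 * (f (q t + l%:C *: v) - f (q t) - 'd f (q t) (l%:C *: v))).
  have -> : 'd f (q t) (l%:C *: v) = l%:C * 'd f (q t) v by rewrite linearZ.
  by rewrite [in RHS]mulrBr [in RHS](mulKf lC) opprB.
rewrite normcN normcM normcV normc_real (gtr0_norm l0) ler_pdivrMl//.
apply: le_trans (taylor t lvd) _; rewrite lv.
have -> : 576 * M * (l * rnorm v / d) ^+ 2 = l * (l * K) by rewrite /K; ring.
rewrite ler_wpM2l ?(ltW l0)//.
have : l <= ep / (K + 1) by rewrite /l ge_min lexx.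
by rewrite ler_pdivlMr//; lra.
Qed.

Let L v := cmean (fun t => 'd f (q t) v).

Let L_linear : linear (L : V -> C).
Proof.
move=> a u v; rewrite /L.
have -> : (fun t => 'd f (q t) (a *: u + v)) = (fun t => a * 'd f (q t) u + 'd f (q t) v).
  by apply/funext => t; rewrite linearP.
rewrite cmeanD//; last by move=> ?; exact/ccontZ.
by rewrite cmeanZ.
Qed.

(** The differential is the mean [L] of the differentials along the circle, since the Taylor bound
    is uniform in the angle. *)
Lemma cmean_differentiable :
  differentiable (fun z => cmean (fun t => f (z + circ r t *: e)) : C) x.
Proof.
pose glM := GRing.isLinear.Build _ _ _ _ _ L_linear.
pose Ll : {linear V -> C} := HB.pack (L : V -> C) glM.
have shE v : (fun t => f (x + v + circ r t *: e)) = (fun t => f (q t + v)).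
  by apply/funext => t; rewrite addrAC.
have d30 : 0 < d / 3 by rewrite divr_gt0.
have K0 : 0 <= 1152 * M / d ^+ 2.
  by apply: divr_ge0; [apply: mulr_ge0; [exact: ler0n|exact: M0]|exact/exprn_ge0/ltW].
(* A single constant has to meet both bounds of [differentiable_quad]: [2 * M] is for the values,
   and [1152 * M / d ^+ 2], twice the Taylor constant, for the remainder. *)
apply: (@differentiable_quad _ _ _ _ Ll (d / 3) (2 * M + 1152 * M / d ^+ 2)) => // v vd.
  have vd' : rnorm v <= d by have := d0; lra.
  rewrite shE; apply: (@le_trans _ _ (2 * M)); last by rewrite lerDl.
  apply: normc_cmean_le => t; first exact: ccont_f.
  by have [] := H t vd'.
have vd' : rnorm v <= d by have := d0; lra.
rewrite shE /= /L -!cmeanB//; first last.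
- by move=> t; exact: ccont_f.
- by move=> t; apply: ccontB => //; exact: ccont_f.
apply: (@le_trans _ _ (2 * (576 * M * (rnorm v / d) ^+ 2))).
  apply: normc_cmean_le => t; last exact/taylor/ltW.
  by apply: ccontB; [apply: ccontB; [exact: ccont_f|exact: ccont_f0]|exact: ccont_d].
have -> : 2 * (576 * M * (rnorm v / d) ^+ 2) = 1152 * M / d ^+ 2 * rnorm v ^+ 2.
  by field; rewrite gt_eqF.
by rewrite ler_wpM2r ?exprn_ge0 ?rnorm_ge0// lerDr mulr_ge0.
Qed.

End At.

Lemma cmean_differentiable_near (f : V -> C) (y e : V) (r d : R) : 0 < r -> 0 < d ->
  (forall th v, rnorm v < d -> differentiable f (y + circ r th *: e + v)) ->
  exists2 s : R, 0 < s & forall x, rnorm (x - y) < s ->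
    differentiable (fun z => cmean (fun t => f (z + circ r t *: e)) : C) x.
Proof.
move=> r0 d0 df.
have [|d1 [M [d10 H]]] := @circle_bound _ _ f y e r r0.
  by move=> th; rewrite -[_ + _]addr0; apply: df; rewrite rnorm0.
(* With a third, [x - y + v] has norm at most [2 * s], which lies inside both radii. *)
pose s := Num.min d d1 / 3.
have m0 : 0 < Num.min d d1 by rewrite lt_min d0.
have s0 : 0 < s by rewrite divr_gt0.
have [md md1] : Num.min d d1 <= d /\ Num.min d d1 <= d1 by rewrite !ge_min !lexx orbT.
exists s; first exact: s0.
move=> x xs.
apply: (@cmean_differentiable _ _ _ _ s M) => // th v vs.
have E : x + circ r th *: e + v = y + circ r th *: e + ((x - y) + v).
  by rewrite addrA; congr (_ + v); rewrite addrAC subrKC.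
have sv : rnorm (x - y + v) <= 2 * s by have := rnormD (x - y) v; lra.
by rewrite E; split; [apply: df|apply: H]; rewrite /s in s0 sv *; lra.
Qed.

End CircleMean.

Lemma near_rnorm (R : realType) (V : normedModType R[i]) (y : V) (s : R) : 0 < s ->
  \forall x \near y, rnorm (x - y) < s.
Proof.
move=> s0; have s0' : 0 < s%:C by rewrite ltcR.
near=> x; rewrite -ltcR -rnormE distrC; near: x; exact: cvgr_dist_lt.
Unshelve. all: by end_near. Qed.

(** * Extension across a coordinate subspace *)

Section Hartogs.
Context {R : realType} {n : nat}.
Local Notation C := (R[i]^o).
Local Notation V := ('rV[R[i]]_n : normedModType R[i]).

(** The averaging circles lie in direction [i0] and miss [S], because that coordinate is nonzero on
    them. Where coordinate [i1] is nonzero, the whole disc misses [S] and the mean value property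
    gives [F = f]; the other points off [S] follow by continuity. *)
Theorem hartogs (i0 i1 : 'I_n) (S : set V) (f : V -> C) (y : V) (d : R) :
  i0 != i1 -> 0 < d -> y 0 i0 = 0 ->
  (forall x : V, S x -> x 0 i0 = 0 /\ x 0 i1 = 0) ->
  (forall x : V, rnorm (x - y) < d -> ~ S x -> differentiable f x) ->
  exists F : V -> C, (\forall x \near y, differentiable F x) /\
    (\forall x \near y, ~ S x -> F x = f x).
Proof.
move=> i01 d0 y0 SS df.
pose e : V := delta_mx 0 i0; pose r := d / 2.
have r0 : 0 < r by rewrite divr_gt0.
have e1 : rnorm e <= 1 by exact: rnorm_delta.
have we (w : C) : rnorm (w *: e) <= normc w.
  by rewrite rnormZ ler_piMr// normc_ge0.
have [|s s0 Fd] := @cmean_differentiable_near _ _ f y e r r r0 r0.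
  move=> th v vr; apply: df.
    have -> : y + circ r th *: e + v - y = circ r th *: e + v.
      by rewrite -(addrA y) addrAC subrr add0r.
    apply: le_lt_trans (rnormD _ _) _.
    have := we (circ r th); rewrite normc_circ ?(ltW r0)// => cr.
    by rewrite [ltRHS]splitr; exact: ler_ltD.
  (* On [S], coordinate [i0] of [v] would have modulus [r], against [rnorm v < r]. *)
  move=> /SS[+ _]; rewrite !mxE y0 !eqxx add0r mulr1.
  move=> /eqP; rewrite addr_eq0 => /eqP cv.
  have := rnorm_coord v i0; rewrite -normcN -cv normc_circ ?(ltW r0)//.
  by rewrite leNgt vr.
set F := fun z => _ in Fd.
pose m := Num.min s r; have m0 : 0 < m by rewrite lt_min s0.
have [ms mr] : m <= s /\ m <= r by rewrite !ge_min !lexx orbT.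
have Ff (x : V) : rnorm (x - y) < m -> x 0 i1 != 0 -> F x = f x.
  move=> xm x1.
  have dl (w : C) : normc w <= r -> derivable (fun l : C => f (x + l *: e)) w 1.
    move=> wr; have [|//] := @line_derivable _ _ f x e w.
    apply: df.
      rewrite addrAC; apply: le_lt_trans (rnormD _ _) _.
      by have := we w; rewrite /r in mr wr *; lra.
    (* Moving along [e] leaves coordinate [i1] unchanged. *)
    move=> /SS[_]; rewrite !mxE eq_sym (negbTE i01) andbF mulr0 addr0 => /eqP.
    by rewrite (negbTE x1).
  have := @mean_value _ (fun l : C => f (x + l *: e)) 0 r r0.
  rewrite scale0r addr0 (_ : (fun t => _) = (fun t => f (x + circ r t *: e))); last first.
    by apply/funext => t; rewrite add0r.
  by apply=> w; rewrite subr0; exact: dl.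
exists F; split.
  near=> x; apply: Fd; apply: lt_le_trans ms; near: x; exact: (@near_rnorm _ V y m m0).
near=> x => nSx.
have xm : rnorm (x - y) < m by near: x; exact: (@near_rnorm _ V y m m0).
have [x1|] := eqVneq (x 0 i1) 0; last exact: Ff.
(* A small shift [v] in direction [i1] leads to a point where [Ff] applies; both functions are
   continuous at [x]. *)
apply/eqP; rewrite -subr_eq0; apply/eqP/normc_small_eq0 => ep ep0.
have ep2 : 0 < ep / 2 by rewrite divr_gt0.
have xd : rnorm (x - y) < d by rewrite /r in mr; lra.
have [s1 s10 hs1] := differentiable_near_le (Fd x (lt_le_trans xm ms)) ep2.
have [s2 s20 hs2] := differentiable_near_le (df x xd nSx) ep2.
pose t := Num.min (Num.min s1 s2) (m - rnorm (x - y)) / 2.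
have mm0 : 0 < Num.min (Num.min s1 s2) (m - rnorm (x - y)).
  by rewrite !lt_min s10 s20 subr_gt0.
have t0 : 0 < t by rewrite divr_gt0.
have tlt : t < Num.min (Num.min s1 s2) (m - rnorm (x - y)).
  by rewrite /t ltr_pdivrMr// ltr_pMr// ltr1n.
move: tlt; rewrite !lt_min => /andP[/andP[ts1 ts2] tm].
pose v : V := t%:C *: delta_mx 0 i1.
have vt : rnorm v <= t.
  rewrite rnormZ normc_real (gtr0_norm t0) ler_piMr ?(ltW t0)//; exact: rnorm_delta.
have Fv : F (x + v) = f (x + v).
  apply: Ff.
    by rewrite addrAC; apply: le_lt_trans (rnormD _ _) _; lra.
  rewrite !mxE x1 !eqxx add0r mulr1; apply/eqP => /complexI t00.
  by rewrite t00 ltxx in t0.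
have -> : F x - f x = (f (x + v) - f x) - (F (x + v) - F x).
  by rewrite Fv opprB [RHS]addrC subrKA.
apply: le_trans (normcB _ _) _; rewrite [leRHS]splitr lerD//.
  by apply: hs2; exact: le_lt_trans ts2.
by apply: hs1; exact: le_lt_trans ts1.
Unshelve. all: by end_near. Qed.

End Hartogs.

(** * Descent of sections along the blow-up *)

Section Charts.
Context {R : realType}.

Lemma differentiable_near_eq (V W : normedModType R[i]) (f h : V -> W) x :
  (\forall y \near x, f y = h y) -> differentiable h x -> differentiable f x.
Proof.
move=> fh dh; have dc := diff_continuous dh.
have E : f \o shift x = (cst (f x) + 'd h x) +o_ (0 : V) id.
  apply/eqaddoP => e e0.
  have H := differentiable_near dh e0.
  have fh0 : \forall v \near (0 : V), f (v + x) = h (v + x).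
    by move: fh; rewrite (near_shift 0); apply: filterS => v; rewrite /= subr0.
  apply: filterS2 H fh0 => v Hv fv.
  have fx : f x = h x by exact: (nbhs_singleton fh).
  by rewrite /= !fctE /= fv fx opprD addrA (addrC v).
by apply/diff_locallyP; rewrite (diff_unique dc E).
Qed.

Lemma holo_in_chart_trans (X : topologicalType) (V W U : normedModType R[i])
    (f : X -> V) (g : X -> W) (k : X -> U) p : {for p, continuous f} ->
  holo_in_chart f g p -> holo_in_chart g k p -> holo_in_chart f k p.
Proof.
move=> fc [h1 [dh1 gE]] [h2 [dh2 kE]]; exists (h2 \o h1).
have h1p : h1 (f p) = g p by rewrite (nbhs_singleton gE).
have c1 : {for f p, continuous h1}.
  exact/differentiable_continuous/(nbhs_singleton dh1).
split.
  have : \forall y \near f p, differentiable h2 (h1 y).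
    by move: dh2; rewrite -h1p; exact: (c1 [set z | differentiable h2 z]).
  apply: filterS2 dh1 => y d1 d2; exact: differentiable_comp.
by apply: filterS2 gE kE => q /= -> ->.
Qed.

Lemma holo_in_chart_precomp (Y X : topologicalType) (V W : normedModType R[i])
    (f : X -> V) (g : X -> W) (u : Y -> X) p : {for p, continuous u} ->
  holo_in_chart f g (u p) -> holo_in_chart (f \o u) (g \o u) p.
Proof. by move=> uc [h [dh gE]]; exists h; split=> //; exact: (uc _ gE). Qed.

Lemma holo_in_chart_near (X : topologicalType) (V W : normedModType R[i])
    (f : X -> V) (g k : X -> W) p : (\forall q \near p, k q = g q) ->
  holo_in_chart f g p -> holo_in_chart f k p.
Proof.
move=> kg [h [dh gE]]; exists h; split=> //.
by apply: filterS2 kg gE => q -> ->.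
Qed.

Lemma holo_in_chart_continuous (X : topologicalType) (V W : normedModType R[i])
    (f : X -> V) (g : X -> W) p : {for p, continuous f} ->
  holo_in_chart f g p -> {for p, continuous g}.
Proof.
move=> fc [h [dh gE]].
have hc : {for f p, continuous h}.
  exact/differentiable_continuous/(nbhs_singleton dh).
have : {for p, continuous (h \o f)} by exact: continuous_comp.
rewrite /prop_for /continuous_at /= -(nbhs_singleton gE) => H.
by apply: cvg_trans H; apply: near_eq_cvg; apply: filterS gE.
Qed.

Section Manifold.
Context {n : nat}.
Implicit Types X Y : complexManifold R n.

Lemma chart_continuous X (c : chart R n X) p : is_chart c -> c.1 p ->
  {for p, continuous (c.2 : X -> 'rV[R[i]]_n : normedModType R[i])}.
Proof. by move=> [_ _ H _]; exact: H. Qed.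

Lemma atlas_chart_continuous X (c : chart R n X) p : atlas c -> c.1 p ->
  {for p, continuous (c.2 : X -> 'rV[R[i]]_n : normedModType R[i])}.
Proof. by move=> /atlas_chart; exact: chart_continuous. Qed.

Lemma holo_in_atlas X (W : normedModType R[i]) (c d : chart R n X) (g : X -> W) p :
  admissible c -> atlas d -> c.1 p -> d.1 p ->
  holo_in_chart c.2 g p -> holo_in_chart d.2 g p.
Proof.
move=> [_ cd] ad cp dp; have [_ dc] := cd d ad p cp dp.
by apply: holo_in_chart_trans dc; exact: atlas_chart_continuous.
Qed.

Lemma holo_in_admissible X (W : normedModType R[i]) (c d : chart R n X) (g : X -> W) p :
  admissible c -> atlas d -> c.1 p -> d.1 p ->
  holo_in_chart d.2 g p -> holo_in_chart c.2 g p.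
Proof.
move=> [ic cd] ad cp dp; have [dc _] := cd d ad p cp dp.
by apply: holo_in_chart_trans dc; exact: chart_continuous.
Qed.

Lemma holomorphic_on_continuous X (W : normedModType R[i]) (U : set X) (g : X -> W) p :
  holomorphic_on U g -> U p -> {for p, continuous g}.
Proof.
move=> hg Up; have [c ac cp] := atlas_cover p.
by apply: holo_in_chart_continuous (hg c p ac cp Up); exact: atlas_chart_continuous.
Qed.

Lemma holomorphic_on_comp X Y (W : normedModType R[i]) (A : set Y) (U : set X)
    (u : Y -> X) (g : X -> W) :
  holomorphic_map_on A u -> holomorphic_on U g ->
  holomorphic_on (A `&` u @^-1` U) (g \o u).
Proof.
move=> [uc uh] gh c p ac cp [Ap Up]; have [e ae ep] := atlas_cover (u p).
have H : holo_in_chart (e.2 \o u) (g \o u) p.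
  by apply: holo_in_chart_precomp; [exact: uc|exact: gh].
apply: holo_in_chart_trans H; first exact: atlas_chart_continuous.
exact: uh.
Qed.

Lemma open_image_ball X (c : chart R n X) (W : set X) z : is_chart c -> open W ->
  W `<=` c.1 -> W z -> exists2 d : R, 0 < d &
  forall v : 'rV[R[i]]_n, rnorm (v - c.2 z : ('rV[R[i]]_n : normedModType R[i])) < d ->
    exists2 x, W x & c.2 x = v.
Proof.
move=> [_ _ _ H] oW Wc Wz; have oI := H W oW Wc.
have : \forall v \near (c.2 z : ('rV[R[i]]_n : normedModType R[i])), (c.2 @` W) v.
  by apply: open_nbhs_nbhs; split => //; exists z.
move=> /nbhs_normc[d d0 hd]; exists d => // v vd.
by have [|x Wx xv] := hd v; [rewrite rnormE ltcR|exists x].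
Qed.

(** * Geometry of the blow-up *)

Section Blowup.
Variables (r : nat) (X Xt : complexManifold R n) (Z : set X) (pi : Xt -> X).
Hypotheses (r2 : (2 <= r)%N) (Zsub : closed_submanifold Z r) (bl : is_blowup Z r pi).

(** Over a point of [Z] the first [r] coordinates vanish, so every line is incident to it; the first
    coordinate line is taken. *)
Lemma blowup_surj x : exists p, pi p = x.
Proof.
have [Zx|nZx] := pselect (Z x); last first.
  by have [g [gE _ _]] := blowup_off bl; exists (g x); exact: gE.
have [c [[_ rn' cZ] cx [rn [k [_ _ H _]]]]] := blowup_on bl Zx.
have r0 : (0 < r)%N by exact: leq_trans r2.
have [|p px _] := H x (delta_mx 0 (Ordinal r0)) cx; last by exists p.
split=> [|i j].
  apply/eqP => /matrixP/(_ 0 (Ordinal r0)); rewrite !mxE !eqxx => /eqP.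
  by rewrite oner_eq0.
by rewrite !((cZ x cx).1 Zx) ?mul0r //=.
Qed.

(** In the affine chart [k_j != 0] the exceptional divisor lies in the zero set of coordinate [J],
    which is [x_j] itself; a small step in that coordinate leaves it. *)
Lemma exceptional_nowhere_dense (p : Xt) (A : set Xt) : nbhs p A -> exists2 q, A q & ~ Z (pi q).
Proof.
move=> nA; have [Zp|] := pselect (Z (pi p)); last by move=> ?; exists p => //; exact: nbhs_singleton.
have [c [[_ rn' cZ] cp [rn [k [kinc _ _ kadm]]]]] := blowup_on bl Zp.
have [k0 _] := kinc p cp.
have [j kj] : exists j, k p 0 j != 0.
  apply: contrapT => H; case/negP: k0; apply/eqP/matrixP => i j; rewrite ord1 mxE.
  by apply/eqP; apply: contrapT => /negP kj; apply: H; exists j.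
pose E : chart R n Xt := ([set q | c.1 (pi q) /\ k q 0 j != 0],
  fun q => affine_coord j (c.2 (pi q)) (k q)).
have [cE _] : admissible E by exact: kadm.
have oE : open E.1 by case: cE.
have [||d d0 hd] := @open_image_ball Xt E (A° `&` E.1) p cE _ (@subIsetr _ _ _).
- by apply: openI => //; exact: open_interior.
- by split.
pose J := widen_ord rn j.
have affJ q : affine_coord j (c.2 (pi q)) (k q) 0 J = c.2 (pi q) 0 J.
  rewrite mxE; case: insubP => [j' _ jE|]; last by rewrite /= ltn_ord.
  by rewrite (_ : j' = j) ?eqxx//; apply: val_inj; rewrite jE.
have d20 : 0 < d / 2 by rewrite divr_gt0.
pose v : 'rV[R[i]]_n := (d / 2)%:C *: delta_mx 0 J.
have [|q [Aq [cq kq]] qv] := hd (E.2 p + v).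
  rewrite addrAC subrr add0r; apply: le_lt_trans (_ : d / 2 < d); last first.
    by rewrite ltr_pdivrMr// ltr_pMr// ltr1n.
  rewrite rnormZ normc_real (gtr0_norm d20) ler_piMr ?(ltW d20)//; exact: rnorm_delta.
exists q; first exact: interior_subset.
move=> Zq; have := congr1 (fun M : 'rV__ => M 0 J) qv.
rewrite [LHS]affJ mxE [X in _ = X + _]affJ !mxE !eqxx mulr1.
rewrite ((cZ _ cq).1 Zq)//= ((cZ _ cp).1 Zp)//= add0r => /complexI d2.
by rewrite -d2 ltxx in d20.
Qed.

(** * Descent of holomorphic functions *)

Section Descent.
Local Notation V := ('rV[R[i]]_n : normedModType R[i]).
Variables (U : set X) (t : Xt -> R[i]^o).
Hypotheses (oU : open U) (ht : holomorphic_on (pi @^-1` U) t).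
Variable g : X -> Xt.
Hypotheses (gK : forall x, ~ Z x -> pi (g x) = x)
  (piK : forall p, ~ Z (pi p) -> g (pi p) = p)
  (hg : holomorphic_map_on (~` Z) g).

Let tg_holo (d : chart R n X) x : atlas d -> d.1 x -> ~ Z x -> U x ->
  holo_in_chart d.2 (t \o g) x.
Proof.
move=> ad dx nZx Ux.
by apply: (holomorphic_on_comp hg ht ad dx); split=> //=; rewrite gK.
Qed.

Let pi_continuous p : {for p, continuous pi}.
Proof. by have [H _] := blowup_holo bl; exact: H. Qed.

(** [F] is the Hartogs extension of [t \o g] read in an adapted chart. The last clause covers all
    points of each fibre, so it also shows that [t] is constant on the fibres over [Z]. *)
Lemma descent_local z : Z z -> U z -> exists (c : chart R n X) (F : V -> R[i]^o),
  [/\ admissible c, c.1 z,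
   \forall y \near (c.2 z : V), differentiable F y &
   \forall x \near z, forall p, pi p = x -> t p = F (c.2 x)].
Proof.
move=> Zz Uz; have [c [[adc rn cZ] cz _]] := blowup_on bl Zz.
have [ic _] := adc; have [oc cinj cc copen] := ic.
pose W := c.1 `&` U.
have oW : open W by exact: openI.
have [d d0 hd] := open_image_ball ic oW (@subIsetl _ _ _) (conj cz Uz).
(* An inverse of the chart; the default [z] is returned only outside the image of [c.1]. *)
pose inv (v : 'rV[R[i]]_n) := xget z [set x | c.1 x /\ c.2 x = v].
have invK x : c.1 x -> inv (c.2 x) = x.
  move=> cx; have [] := @xgetPex _ z [set x' | c.1 x' /\ c.2 x' = c.2 x].
    by exists x.
  by move=> ci ce; exact: cinj.
pose f (v : V) := t (g (inv v)).
pose S := [set v : V | forall i : 'I_n, (i < r)%N -> v 0 i = 0].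
have r0n : (0 < n)%N by apply: leq_trans rn; exact: leq_trans r2.
have r1n : (1 < n)%N by apply: leq_trans rn.
have [||v vS|v vd nSv|F [dF FE]] := @hartogs R n (Ordinal r0n) (Ordinal r1n) S f (c.2 z) d _ d0.
- by [].
- by rewrite ((cZ z cz).1 Zz)//=; exact: leq_trans r2.
- by split; apply: vS => //=; exact: leq_trans r2.
- have [x [cx Ux] xv] := hd v vd.
  have nZx : ~ Z x by move=> /(cZ x cx).1 Sx; apply: nSv; rewrite -xv.
  have [e ae ex] := atlas_cover x.
  have [h [dh hE]] := holo_in_admissible adc ae cx ex (tg_holo ae ex nZx Ux).
  (* Near [v], [f] agrees with the local factor [h] of [t \o g]. *)
  rewrite xv in dh; apply: differentiable_near_eq (nbhs_singleton dh).
  pose N := [set x' | t (g x') = h (c.2 x')]° `&` c.1.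
  have [||d' d'0 hd'] := @open_image_ball _ c N x ic _ (@subIsetr _ _ _).
  - by apply: openI => //; exact: open_interior.
  - by split.
  near=> y.
  have [|x' [x'N cx'] <-] := hd' y.
    by rewrite xv; near: y; exact: (@near_rnorm _ V v d' d'0).
  by rewrite /f invK//; exact: (interior_subset x'N).
exists c, F; split => //.
have cont_c := chart_continuous ic.
pose N := [set x | [/\ c.1 x, U x, differentiable F (c.2 x : V) &
   (~ Z x -> F (c.2 x) = t (g x))]].
have nN : \forall x \near z, N x.
  have n1 := open_nbhs_nbhs (conj oW (conj cz Uz) : open_nbhs z W).
  have n2 := cont_c _ cz _ dF; have n3 := cont_c _ cz _ FE.
  near=> x; have [cx Ux] : W x by near: x.
  split => //; first by near: x.
  move=> nZx; have -> : F (c.2 x) = f (c.2 x).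
    have : ~ S (c.2 x) -> F (c.2 x) = f (c.2 x) by near: x.
    by apply=> /(cZ x cx).2.
  by rewrite /f invK.
(* Passing to the interior makes [N] hold around each such [x], hence at [pi q] for every [q] near
   [p]. *)
have : nbhs z N° by exact: nbhs_interior.
apply: filterS => x Nx p px.
have [cx Ux dx _] := interior_subset Nx.
(* If [t] and [F] differed at [p], they would differ near [p], also at points off the exceptional
   divisor, where they agree. *)
apply: contrapT => /eqP; rewrite -subr_eq0 => tF.
have Fc : {for p, continuous (fun q => t q - F (c.2 (pi q)))}.
  apply: continuousB.
    by apply: holomorphic_on_continuous ht _; rewrite /= px.
  have c1 : {for p, continuous (c.2 \o pi : Xt -> ('rV[R[i]]_n : normedModType R[i]))}.
    by apply: continuous_comp; [exact: pi_continuous|apply: cont_c; rewrite px].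
  apply: (@continuous_comp _ _ _ (c.2 \o pi : Xt -> ('rV[R[i]]_n : normedModType R[i])) F) => //.
  by apply: differentiable_continuous; rewrite /= px.
have nz : \forall q \near p, t q - F (c.2 (pi q)) != 0.
  by apply: (cvgr_neq0 _ Fc); rewrite /= px.
have nNp : \forall q \near p, N (pi q).
  have H : nbhs (pi p) N by rewrite px; exact: Nx.
  exact: (@pi_continuous p N H).
have [q [qN /eqP qz] nZq] := exceptional_nowhere_dense (filterI nNp nz).
have [_ _ _ FE'] := qN.
by apply: qz; rewrite FE'// piK// subrr.
Unshelve. all: by end_near. Qed.

(** [t] is composed with an arbitrary set-theoretic section [sg] of [pi]. By [descent_local] the
    choice over [Z] does not affect the values, and near [Z] the composite is [F] read in the
    chart. *)
Lemma descent : exists s : X -> R[i]^o,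
  holomorphic_on U s /\ forall p, U (pi p) -> t p = s (pi p).
Proof.
have [sg sgK] := choice blowup_surj.
have gE x : ~ Z x -> sg x = g x by move=> nZx; rewrite -(piK (p := sg x)) ?sgK.
exists (t \o sg); split=> [d x ad dx Ux|p Up]; last first.
  have [Zp|nZp] := pselect (Z (pi p)); last by rewrite /= gE// piK.
  have [c [F [_ _ _ /nbhs_singleton tF]]] := descent_local Zp Up.
  by rewrite /= (tF p)// (tF (sg (pi p))).
have [Zx|nZx] := pselect (Z x).
  have [c [F [adc cx dF tF]]] := descent_local Zx Ux.
  apply: (holo_in_atlas adc ad cx dx); exists F; split=> //.
  by apply: filterS tF => y; exact.
apply: holo_in_chart_near (tg_holo ad dx nZx Ux).
have [cZ _] := Zsub.
have : \forall y \near x, (~` Z) y by apply: open_nbhs_nbhs; split=> //; exact: closed_openC.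
by apply: filterS => y nZy; rewrite /= gE.
Qed.

End Descent.

Lemma holomorphic_descent (U : set X) (t : Xt -> R[i]^o) : open U ->
  holomorphic_on (pi @^-1` U) t -> exists s : X -> R[i]^o,
  holomorphic_on U s /\ forall p, U (pi p) -> t p = s (pi p).
Proof.
by move=> oU ht; have [g [gK piK hg]] := blowup_off bl; exact: (descent oU ht gK piK hg).
Qed.

(** * Pullback of line bundles and of their sections *)

Definition lb_pullback (L : lineBundle X) : lineBundle Xt :=
  @LineBundle R n Xt (lidx L) (fun i => pi @^-1` ldom i)
    (fun i j p => ltr i j (pi p)).

Let pull (L : lineBundle X) (s : lidx L -> X -> R[i]^o) :
  lidx L -> Xt -> R[i]^o := fun i p => s i (pi p).

Let pull_sum (L : lineBundle X) d (a : 'I_d -> R[i]) (v : 'I_d -> lidx L -> X -> R[i]^o) :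
  @pull L (\sum_(k < d) a k *: v k) = \sum_(k < d) a k *: @pull L (v k).
Proof. exact: (big_morph (@pull L) (fun _ _ => erefl) erefl). Qed.

Let pull_eq0 (L : lineBundle X) (s : lidx L -> X -> R[i]^o) : @pull L s = 0 -> s = 0.
Proof.
move=> s0; apply/funext => i; apply/funext => x; have [p <-] := blowup_surj x.
exact: (congr1 (fun h => h i p) s0).
Qed.

Lemma H0_pull (L : lineBundle X) s : H0 L s -> H0 (lb_pullback L) (@pull L s).
Proof.
move=> [hs s0 sE]; split => /= [i|i p ni|i j p].
- move=> c p ac cp Up.
  by apply: (holomorphic_on_comp (blowup_holo bl) (hs i) ac cp).
- exact: s0.
- exact: sE.
Qed.

(** Each local representative descends separately; the transition relations follow by surjectivity
    of [pi]. *)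
Lemma H0_descent (L : lineBundle X) t : (forall i, open (@ldom _ _ _ L i)) ->
  H0 (lb_pullback L) t -> exists2 s, H0 L s & @pull L s = t.
Proof.
move=> oL [ht t0 tE].
have [s sP] := choice (fun i => holomorphic_descent (oL i) (ht i)).
(* [H0] demands the value 0 outside the trivialising open sets, which descent alone does not
   ensure. *)
pose s' i x := if pselect (ldom i x) then s i x else 0.
have s'E i x : ldom i x -> s' i x = s i x by rewrite /s'; case: pselect.
have s'0 i x : ~ ldom i x -> s' i x = 0 by rewrite /s'; case: pselect.
have pE i p : s' i (pi p) = t i p.
  have [ip|nip] := pselect (ldom i (pi p)); last by rewrite s'0// t0.
  by rewrite s'E// (sP i).2.
exists s'; last by apply/funext => i; apply/funext => p; exact: pE.
split=> // [i c x ac cx ix|i j x ix jx].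
  apply: holo_in_chart_near ((sP i).1 c x ac cx ix).
  have : \forall y \near x, ldom i y by apply: open_nbhs_nbhs; split.
  by apply: filterS => y; exact: s'E.
have [p px] := blowup_surj x; rewrite -px in ix jx *.
by rewrite !pE; exact: tE.
Qed.

(** Pullback is a linear bijection between the spaces of sections, so independent families of each
    size correspond. *)
Lemma h0_pullback (L : lineBundle X) : (forall i, open (@ldom _ _ _ L i)) ->
  h0 (lb_pullback L) = h0 L.
Proof.
move=> oL; rewrite /h0 /dimension; congr ereal_sup; congr image.
apply/seteqP; split => d /= [v [Hv indep]].
  have [w wP] := choice (fun k => let: ex_intro2 s a b := H0_descent oL (Hv k) in
    ex_intro (fun s => H0 L s /\ @pull L s = v k) s (conj a b)).
  exists w; split=> [k|a aw]; first exact: (wP k).1.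
  have vE : v = fun k => @pull L (w k) by apply/funext => k; rewrite (wP k).2.
  by apply: indep; rewrite vE; have := pull_sum a w; rewrite aw => /esym.
exists (fun k => @pull L (v k)); split=> [k|a aw]; first exact/H0_pull.
by apply: indep; apply: pull_eq0; rewrite pull_sum.
Qed.

(** Powers of a bundle commute with pullback by conversion and keep the same open sets, so
    [h0_pullback] applies for each [m]. *)
Lemma vol_pullback (L : lineBundle X) : (forall i, open (@ldom _ _ _ L i)) ->
  vol (lb_pullback L) = vol L.
Proof.
move=> oL; rewrite /vol; congr limn_esup; apply/funext => m; congr (_ * _)%E.
exact: (@h0_pullback (lb_power L m)).
Qed.

Lemma div_vol_pullback (D : divisor X) : (forall i, open (@ddom _ _ _ D i)) ->
  div_vol (div_pullback pi D) = div_vol D.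
Proof. exact: (@vol_pullback (line_bundle_of D)). Qed.

End Blowup.

(** * Pullback of Q-divisors *)

(** Sums and multiples of divisors act pointwise on the local data, hence commute with pullback by
    conversion. *)
Lemma qdiv_multiple_pullback X Y (u : Y -> X) (a : nat) (D : qdivisor X) :
  qdiv_multiple a (qdiv_pullback u D) = div_pullback u (qdiv_multiple a D).
Proof.
elim: D => [//|t D IH].
rewrite /qdiv_pullback /qdiv_multiple /= -/(qdiv_multiple a D).
by rewrite -/(qdiv_pullback u D) -/(qdiv_multiple a _) IH.
Qed.

Lemma qdiv_multiple_open X (a : nat) (D : qdivisor X) : is_qdivisor D ->
  forall i, open (@ddom _ _ _ (qdiv_multiple a D) i).
Proof.
elim: D => [_ i|t D IH [Dt /IH oD] [i j]]; first exact: openT.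
by apply: openI; [exact: (div_open Dt i)|exact: oD].
Qed.

End Manifold.
End Charts.

Theorem proposition6p10 (R : realType) (n r : nat)
    (X Xt : complexManifold R n) (Z : set X) (pi : Xt -> X)
    (X_compact : compact [set: X])
    (r_ge2 : (2 <= r)%N)
    (Z_sub : closed_submanifold Z r)
    (pi_blowup : is_blowup Z r pi) :
  (forall D : divisor X, is_divisor D ->
     div_vol (div_pullback pi D) = div_vol D) /\
  (forall D : qdivisor X, is_qdivisor D ->
     forall a : nat, (0 < a)%N -> clears a D ->
       qdiv_vol a (qdiv_pullback pi D) = qdiv_vol a D).
Proof.
split=> [D [oD _ _ _ _ _]|D Dq a a0 _].
  exact: (div_vol_pullback r_ge2 Z_sub pi_blowup oD).
rewrite /qdiv_vol qdiv_multiple_pullback; congr (_ * _)%E.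
exact: (div_vol_pullback r_ge2 Z_sub pi_blowup (qdiv_multiple_open Dq)).
Qed.
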